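(* There exists an absolute constant $C\in\mathbb{N}$ such that the following holds. Let $G$ be a finite abelian group of even order $n$ with $G=\mathbb{Z}_{2^{\alpha_1}}\oplus\cdots\oplus\mathbb{Z}_{2^{\alpha_r}}\oplus K$, where $r,\alpha_1,\dots,\alpha_r$ are positive integers ($r$ may depend on $n$) and $K$ is an abelian group of odd order. If $n/2^r\geq C$, then $f^\star_{\max}(G)=2^{n/4+o(n)}$, where $o(n)$ denotes a quantity depending only on $n$ (not on the particular group) whose ratio to $n$ tends to $0$ as $n\to\infty$.
   Context: For a finite abelian group $(G,+)$: a triple $x,y,z\in G$ with $x+y=z$ and $x,y,z$ pairwise distinct is a distinct Schur triple. A subset $S\subseteq G$ is distinct sum-free if it contains no distinct Schur triple, and a distinct sum-free set is maximal if it is not properly contained in another distinct sum-free subset of $G$. $f^\star_{\max}(G)$ denotes the number of maximal distinct sum-free subsets of $G$. *)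

(* Defs.v *)
From HB Require Import structures.
From mathcomp Require Import all_boot all_order all_algebra.
From mathcomp Require Import all_classical all_reals all_analysis.

Set Implicit Arguments.
Unset Strict Implicit.
Unset Printing Implicit Defensive.

Import Order.TTheory GRing.Theory Num.Theory.
Import numFieldNormedType.Exports.
Local Open Scope ring_scope.

Definition distinct_schur_triple (G : finZmodType) (x y z : G) : bool :=
  [&& x + y == z, x != y, x != z & y != z].

Definition distinct_sum_free (G : finZmodType) (S : {set G}) : bool :=
  [forall x in S, forall y in S, forall z in S,
    ~~ distinct_schur_triple x y z].

(* [maxset] is maximality for inclusion. *)
Definition max_distinct_sum_free (G : finZmodType) : {set {set G}} :=
  [set S : {set G} | maxset (@distinct_sum_free G) S].

Definition fstar_max (G : finZmodType) : nat := #|max_distinct_sum_free G|.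

(* An isomorphism of G with Z_(2^alpha_1) (+) ... (+) Z_(2^alpha_r) (+) K, the
   group law of the target being componentwise.  ['Z_m] is the ring of integers
   mod m only for m > 1, so this is meant for positive exponents alpha_i. *)
Definition direct_sum_iso (G K : finZmodType) (r : nat) (alpha : 'I_r -> nat)
    (f : G -> {dffun forall i : 'I_r, 'Z_(2 ^ alpha i)} * K) : Prop :=
  [/\ bijective f,
      forall x y i, (f (x + y)).1 i = (f x).1 i + (f y).1 i
    & forall x y, (f (x + y)).2 = (f x).2 + (f y).2].

Definition has_decomposition (G K : finZmodType) (r : nat)
    (alpha : 'I_r -> nat) : Prop :=
  exists f, @direct_sum_iso G K r alpha f.

(* Main.v *)
Require Import Defs.
From mathcomp Require Import all_boot all_order all_algebra fingroup cyclic.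
From mathcomp Require Import ring lra zify.

(** For the lower bound let [B] be the nontrivial coset of a subgroup of index 2
    and [s] an element of its complement with [2 s = 0] (possibly [s = 0]). The
    elements of [B] adjacent in the link graph of [{0, s}] form cliques
    [{x, x + s, -x, s - x}] of size 2 or 4 (at most one of size 1 if no [s <> 0]
    exists), so this graph has about [2 ^ (|B| / 2)] maximal independent sets, and
    these extend to different maximal distinct sum-free sets.

    For the upper bound, [2 ^ o(n)] containers with few Schur triples cover all
    distinct sum-free sets. By the removal lemma a container is a sum-free set [X]
    up to [o(n)] elements, and a maximal [M] with a prescribed part outside [X] is
    given by a maximal independent set of the link graph of that part on [X]. If
    [|X| <= 2n/5], the Moon-Moser bound suffices since [3 ^ (2/15) < 2 ^ (1/4)].
    Otherwise [X] lies in the nontrivial coset [B] of a subgroup of index 2, which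
    we take instead of [X]. If the part of [M] outside [B] is rich enough, the link
    graph on [B] contains a nearly 4-regular graph, because few [x] satisfy
    [2 x = c] when [n / 2 ^ r] is large, and branching on vertices of degree at
    least 3 gives fewer than [2 ^ (|B| / 2)] maximal independent sets. In the
    remaining cases that part is contained in [{s}], or is [{0, s}] with [2 s = 0]. *)

(** On [B] the Moon-Moser bound only gives 3^(n/6), which exceeds 2^(n/4), and it can be attained:
    in Z_2^r + Z_3, with [s] of order 3, the link graph of [{s}] on [B] is a disjoint union of
    triangles, because the reflection [s - x] of [x] falls back into [x + <s>]. This is what a large
    n/2^r prevents. At most 2^r elements have a given double, so outside a few exceptional [x] the
    reflections differ from the translates of [x] and tie the triangles together. Every ordinary
    vertex then saves a constant factor close to 1, and these savings have to pay for the
    exceptional vertices. At most 6 values of [2 x] are exceptional, one exceptional vertex among 32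
    is affordable, and [B] is half of the group: this gives 2 * 6 * 32 = 384 for the constant C. *)

Set Implicit Arguments.
Unset Strict Implicit.
Unset Printing Implicit Defensive.

Import Order.TTheory GRing.Theory Num.Theory.
Local Open Scope ring_scope.

(** * Maximal independent sets *)

Section MaximalIndependentSets.
Context {T : finType} (e : rel T).

Definition nbh v : {set T} := [set u | e v u].
Definition cnbh v : {set T} := v |: nbh v.
Definition indep (I : {set T}) :=
  [forall x in I, forall y in I, ~~ e x y].
Definition mis (U I : {set T}) :=
  [&& I \subset U, indep I & [forall x in U :\: I, exists y in I, e x y]].
Definition nmis (U : {set T}) := #|[set I | mis U I]|.

Lemma indepP (I : {set T}) :
  reflect (forall x y, x \in I -> y \in I -> ~~ e x y) (indep I).
Proof.
apply: (iffP forall_inP) => [h x y xI yI|h x xI].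
  exact: (forall_inP (h x xI)).
by apply/forall_inP => y; exact: h.
Qed.

Lemma misP (U I : {set T}) :
  reflect [/\ I \subset U, forall x y, x \in I -> y \in I -> ~~ e x y
    & forall x, x \in U -> x \notin I -> exists2 y, y \in I & e x y]
  (mis U I).
Proof.
apply: (iffP and3P) => -[IU iI mI]; split=> //; first exact/indepP.
- move=> x xU xI; have xUI : x \in U :\: I by rewrite inE xI.
  by have /exists_inP[y yI exy] := forall_inP mI x xUI; exists y.
- exact/indepP.
- apply/forall_inP => x; rewrite inE => /andP[xI xU]; apply/exists_inP.
  by have [y yI exy] := mI x xU xI; exists y.
Qed.

Hypotheses (e_sym : symmetric e) (e_irr : irreflexive e).

Lemma nmis_set0 : (nmis set0 <= 1)%N.
Proof.
rewrite -(cards1 (set0 : {set T})); apply/subset_leq_card/subsetP => I.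
by rewrite !inE => /misP[]; rewrite subset0.
Qed.

(** Removing [v] from [I] loses no information and leaves a maximal independent set of what survives
    the choice of [v]. *)
Lemma nmis_with v (U : {set T}) :
  (#|[set I | mis U I & v \in I]| <= nmis (U :\: cnbh v))%N.
Proof.
pose f I : {set T} := I :\ v.
rewrite -(@card_in_imset _ _ f); last first.
  move=> I J; rewrite !inE => /andP[_ vI] /andP[_ vJ] eIJ.
  by rewrite -(setD1K vI) -(setD1K vJ) -/(f I) eIJ.
apply/subset_leq_card/subsetP => _ /imsetP[I + ->]; rewrite !inE.
move=> /andP[/misP[IU iI mI] vI]; apply/misP; split.
- apply/subsetP => x; rewrite !inE => /andP[xv xI].
  by rewrite negb_or xv (subsetP IU) // iI.
- by move=> x y; rewrite !inE => /andP[_ xI] /andP[_ yI]; apply: iI.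
- move=> x; rewrite !inE negb_or => /andP[/andP[xv evx] xU]; rewrite xv /= => xI.
  have [y yI exy] := mI x xU xI; exists y => //; rewrite !inE yI andbT.
  by apply/eqP => yv; move: exy; rewrite yv e_sym (negPf evx).
Qed.

Lemma nmis_branch v (U : {set T}) :
  (nmis U <= nmis (U :\ v) + nmis (U :\: cnbh v))%N.
Proof.
have -> : nmis U = (#|[set I | mis U I & v \notin I]|
    + #|[set I | mis U I & v \in I]|)%N.
  rewrite addnC -cardsUI setIC -[LHS]addn0; congr (_ + _)%N.
    by apply: eq_card => I; rewrite !inE; case: (v \in I); rewrite ?andbT ?andbF ?orbF.
  by apply/esym/eqP; rewrite cards_eq0 -subset0; apply/subsetP=> I; rewrite !inE; case: (v \in I); rewrite ?andbF.
apply: leq_add (nmis_with _ _).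
apply/subset_leq_card/subsetP => I; rewrite !inE => /andP[/misP[IU iI mI] vI].
apply/misP; split=> //.
  apply/subsetP => x xI; rewrite !inE (subsetP IU) // andbT.
  by apply: contraNneq vI => <-.
by move=> x; rewrite !inE => /andP[_ xU]; apply: mI.
Qed.

(** By maximality each such set contains [v] or a neighbour of [v]. *)
Lemma nmis_nbh v (U : {set T}) : v \in U ->
  (nmis U <= \sum_(u in cnbh v :&: U) nmis (U :\: cnbh u))%N.
Proof.
move=> vU; apply: (@leq_trans (\sum_(u in cnbh v :&: U) #|[set I | mis U I & u \in I]|)%N).
  rewrite /nmis -sum1_card.
  under [X in (_ <= X)%N]eq_bigr => u _ do rewrite -sum1_card big_mkcond /=.
  rewrite exchange_big /= [X in (X <= _)%N]big_mkcond /=.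
  apply: leq_sum => I _; rewrite inE; case: ifP => // mI.
  have [u /setIP[uv uU] uI] : exists2 u, u \in cnbh v :&: U & u \in I.
    have [IU _ {}mI] := misP _ _ mI; have [vI|vI] := boolP (v \in I).
      by exists v; rewrite // inE setU11.
    have [u uI evu] := mI v vU vI; exists u => //.
    by rewrite !inE evu orbT (subsetP IU).
  by rewrite (bigD1 u) /= ?inE ?mI ?uI //; move: uv uU; rewrite !inE => -> ->.
by apply: leq_sum => u _; apply: nmis_with.
Qed.

(** A maximal independent set of [U'] extends to one of [U], and the extension gains no point of
    [U']; so restriction to [U'] reaches all of them. *)
Lemma nmis_mono (U' U : {set T}) : U' \subset U -> (nmis U' <= nmis U)%N.
Proof.
move=> sU; pose f I : {set T} := I :&: U'.
apply: (@leq_trans #|f @: [set I | mis U I]|); last exact: leq_imset_card.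
apply/subset_leq_card/subsetP => I; rewrite inE => /misP[IU iI mI].
pose P (J : {set T}) := (J \subset U) && indep J.
have [|J /maxsetP[/andP[JU /indepP iJ] mJ] IJ] := @maxset_exists _ P I.
  by rewrite /P (subset_trans IU sU); apply/indepP.
apply/imsetP; exists J; last first.
  apply/eqP; rewrite eqEsubset subsetI IJ IU; apply/subsetP => x /setIP[xJ xU].
  apply: contraT => xI; have [y yI exy] := mI x xU xI.
  by move: (iJ x y xJ (subsetP IJ y yI)); rewrite exy.
rewrite inE; apply/misP; split => // x xU xJ; apply/exists_inP.
apply: contraNT xJ; rewrite negb_exists_in => /forall_inP h.
rewrite -(mJ (x |: J)) ?setU11 ?subsetUr // /P subUset sub1set xU JU.
apply/indepP => a b; rewrite !inE => /predU1P[->|aJ] /predU1P[->|bJ].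
- by rewrite e_irr.
- exact: h.
- by rewrite e_sym; apply: h.
- exact: iJ.
Qed.

End MaximalIndependentSets.

(** * Bounds of Moon-Moser type, with weights that may be larger at exceptional vertices *)

Section WeightedBounds.
Context {R : realFieldType} {T : finType} (e : rel T).
Hypotheses (e_sym : symmetric e) (e_irr : irreflexive e).
Variables (w : T -> R) (w0 : R).
Hypotheses (w0_ge1 : 1 <= w0) (w_ge : forall x, w0 <= w x).

Definition weight (U : {set T}) : R := \prod_(x in U) w x.

Let w0_gt0 : 0 < w0.
Proof. exact: lt_le_trans w0_ge1. Qed.

Lemma weight_gt0 U : 0 < weight U.
Proof. by apply: prodr_gt0 => x _; apply: lt_le_trans (w_ge x). Qed.

Lemma weightD (A U : {set T}) : A \subset U -> weight U = weight A * weight (U :\: A).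
Proof.
move=> AU; rewrite /weight (big_setID A) /=; congr (_ * _).
by rewrite (setIidPr AU).
Qed.

Lemma weight_ge_card (A : {set T}) k : (k <= #|A|)%N -> w0 ^+ k <= weight A.
Proof.
move=> kA; apply: (@le_trans _ _ (w0 ^+ #|A|)); first exact: ler_weXn2l.
rewrite -prodr_const; apply: ler_prod => x _; by rewrite w_ge andbT ltW.
Qed.

Lemma weight_setD (A U : {set T}) k :
  (k <= #|A :&: U|)%N -> weight (U :\: A) <= weight U / w0 ^+ k.
Proof.
move=> kA; rewrite ler_pdivlMr; last exact: exprn_gt0.
rewrite (@weightD (A :&: U) U) ?subsetIr // mulrC setDIr setDv setU0.
by apply: ler_wpM2r (weight_ge_card kA); apply/ltW/weight_gt0.
Qed.

Lemma weight_mono (A B : {set T}) : A \subset B -> weight A <= weight B.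
Proof.
move=> AB; rewrite (weightD AB); apply: ler_peMr; first exact/ltW/weight_gt0.
by have := @weight_ge_card (B :\: A) 0 isT; rewrite expr0.
Qed.

Local Notation f U := ((nmis e U)%:R : R).

Lemma nmis_nbh_weight v (U : {set T}) (k : nat) : v \in U ->
  (forall u, u \in cnbh e v :&: U -> (k <= #|cnbh e u :&: U|)%N) ->
  (forall u, u \in cnbh e v :&: U ->
     f (U :\: cnbh e u) <= weight (U :\: cnbh e u)) ->
  f U <= #|cnbh e v :&: U|%:R * (weight U / w0 ^+ k).
Proof.
move=> vU hk hf; apply: (@le_trans _ _ (\sum_(u in cnbh e v :&: U) f (U :\: cnbh e u))).
  by rewrite -natr_sum ler_nat nmis_nbh.
rewrite mulr_natl -sumr_const; apply: ler_sum => u uv.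
by apply: le_trans (hf u uv) (weight_setD (hk u uv)).
Qed.

Lemma proper_setD_cnbh u v (U : {set T}) :
  u \in cnbh e v :&: U -> (#|U :\: cnbh e u| < #|U|)%N.
Proof.
move=> /setIP[_ uU]; apply: proper_card; apply/properP; split; first exact: subsetDl.
by exists u => //; rewrite !inE eqxx.
Qed.

(** Moon-Moser: at a vertex of minimal degree, each of the [k] choices in its closed neighbourhood
    deletes at least [k] vertices, which costs a factor [k / w0 ^+ k]. The hypothesis is most
    demanding at [k = 3]. *)
Lemma nmis_le_weight :
  (forall k : nat, k%:R <= w0 ^+ k) -> forall U : {set T}, f U <= weight U.
Proof.
move=> hw U; have [n] := ubnP #|U|; elim: n U => // n IHn U; rewrite ltnS => hn.
have [->|[v0 v0U]] := set_0Vmem U.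
  by rewrite /weight big_set0 (ler_nat _ _ 1) nmis_set0.
case: (@arg_minnP _ v0 [in U] (fun v => #|cnbh e v :&: U|) v0U) => v vU vmin.
apply: le_trans (nmis_nbh_weight vU (k := #|cnbh e v :&: U|) _ _) _.
- by move=> u /setIP[_ uU]; apply: vmin.
- by move=> u uv; apply: IHn; apply: leq_trans (proper_setD_cnbh uv) hn.
- rewrite mulrCA; apply: ler_piMr; first exact/ltW/weight_gt0.
  by rewrite ler_pdivrMr ?exprn_gt0 // mul1r.
Qed.

(* Graphs of maximal degree 2 are unions of paths and cycles, and among their
   components only a triangle can have more than [sqrt 2 ^ size] maximal
   independent sets. *)
Lemma nmis_le_weight_deg2 : 2 <= w0 ^+ 2 -> forall U : {set T},
  (forall v, v \in U -> (#|nbh e v :&: U| <= 2)%N) ->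
  (forall x y z, x \in U -> y \in U -> z \in U -> e x y -> e y z -> e x z ->
     3 <= w x * w y * w z) ->
  f U <= weight U.
Proof.
move=> hw0 U; have [n] := ubnP #|U|; elim: n U => // n IHn U; rewrite ltnS => hn.
move=> deg tri.
have IH (A : {set T}) : A \proper U -> f A <= weight A.
  move=> pA; have sA := proper_sub pA; apply: IHn.
  - exact: leq_trans (proper_card pA) hn.
  - move=> v vA; apply: leq_trans (deg v (subsetP sA v vA)).
    by apply/subset_leq_card/setIS.
  - by move=> x y z xA yA zA; apply: tri; apply: (subsetP sA).
have [->|[v0 v0U]] := set_0Vmem U.
  by rewrite /weight big_set0 (ler_nat _ _ 1) nmis_set0.
have cnbhI v (A : {set T}) : v \in A -> #|cnbh e v :&: A| = #|nbh e v :&: A|.+1.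
  move=> vA; rewrite setIUl (setIidPl _) ?sub1set // cardsU1.
  by rewrite !inE e_irr.
have Dproper u (A : {set T}) : u \in U -> u \in A -> U :\: A \proper U.
  move=> uU uA; apply/properP; split; first exact: subsetDl.
  by exists u; rewrite // inE uA.
case: (@arg_minnP _ v0 [in U] (fun v => #|nbh e v :&: U|) v0U) => v vU vmin.
have step (d : nat) : #|nbh e v :&: U| = d -> d.+1%:R <= w0 ^+ d.+1 -> f U <= weight U.
  move=> hd hle; apply: le_trans (nmis_nbh_weight vU (k := d.+1) _ _) _.
  - by move=> u /setIP[_ uU]; rewrite cnbhI // ltnS -hd; apply: vmin.
  - move=> u /setIP[_ uU]; apply: IH; apply: (Dproper u) => //.
    by rewrite setU11.
  - rewrite cnbhI // hd mulrCA; apply: ler_piMr; first exact/ltW/weight_gt0.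
    by rewrite ler_pdivrMr ?exprn_gt0 // mul1r.
have := deg v vU; rewrite leq_eqVlt => /predU1P[d2|]; last first.
  rewrite ltnS leq_eqVlt ltnS leqn0 => /predU1P[/step|/eqP/step]; apply.
    exact: hw0.
  by rewrite expr1.
have {vmin}d2 u : u \in U -> #|nbh e u :&: U| = 2.
  by move=> uU; apply/eqP; rewrite eqn_leq deg //=; have := vmin u uU; rewrite d2.
have /cards2P[a [b [ab nv]]] : #|nbh e v :&: U| == 2 by rewrite d2.
have /andP[] : (a \in nbh e v :&: U) && (b \in nbh e v :&: U).
  by rewrite nv !inE !eqxx orbT.
rewrite !inE => /andP[eva aU] /andP[evb bU].
have va : v != a by apply: contraTneq eva => <-; rewrite e_irr.
have vb : v != b by apply: contraTneq evb => <-; rewrite e_irr.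
(* The graph is now 2-regular. If [a] and [b] are adjacent, the triangle is a component and each of
   its three choices leaves at most [A]. *)
have [eab|eab] := boolP (e a b).
  pose A := U :\ v :\ a :\ b.
  have -> : weight U = w v * w a * w b * weight A.
    have aU' : a \in U :\ v by rewrite !inE eq_sym va.
    have bU' : b \in U :\ v :\ a by rewrite !inE eq_sym ab eq_sym vb.
    by rewrite /weight (big_setD1 v vU) (big_setD1 a aU') (big_setD1 b bU') /= !mulrA.
  apply: (@le_trans _ _ (3 * weight A)); last first.
    by apply: ler_wpM2r; [exact/ltW/weight_gt0|apply: tri].
  apply: (@le_trans _ _ (\sum_(u in cnbh e v :&: U) f (U :\: cnbh e u))).
    by rewrite -natr_sum ler_nat nmis_nbh.
  have -> : 3 = #|cnbh e v :&: U|%:R :> R by rewrite cnbhI // d2.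
  rewrite mulr_natl -sumr_const; apply: ler_sum => u uv; have /setIP[uv' uU] := uv.
  apply: le_trans (IH _ _) _; first by apply: (Dproper u); rewrite // setU11.
  apply: weight_mono; apply/subsetP => x; rewrite !inE !negb_or => /andP[/andP[xu eux] xU].
  have : u \in v |: [set a; b].
    by rewrite -nv !inE; move: uv'; rewrite !inE uU andbT.
  rewrite xU andbT !inE => /or3P[]/eqP uE; move: xu eux; rewrite uE.
  - move=> ->; rewrite andbT => evx.
    by rewrite (contraNneq _ evx) ?(contraNneq _ evx) // => ->.
  - move=> ->; rewrite andTb => eax.
    by rewrite (contraNneq _ eax) ?(contraNneq _ eax) // => ->; rewrite // e_sym.
  - move=> ->; rewrite /= => ebx.
    by rewrite (contraNneq _ ebx) ?(contraNneq _ ebx) // => ->; rewrite // e_sym.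
have [a' [ea eaa' a'U va']] : exists a', [/\ nbh e a :&: U = [set v; a'], e a a', a' \in U & v != a'].
  have /cards2P[x [y [xy na]]] : #|nbh e a :&: U| == 2 by rewrite d2.
  have vN : v \in nbh e a :&: U by rewrite !inE e_sym eva vU.
  have : (x \in nbh e a :&: U) && (y \in nbh e a :&: U) by rewrite na !inE !eqxx orbT.
  rewrite !inE => /andP[/andP[eax xU] /andP[eay yU]].
  move: vN; rewrite na !inE => /orP[]/eqP vE.
    by exists y; rewrite vE.
  by exists x; rewrite setUC vE eq_sym.
have eva' : ~~ e v a'.
  apply: contra eab => eva'; have : a' \in nbh e v :&: U by rewrite !inE eva' a'U.
  by rewrite nv !inE => /orP[]/eqP a'E; move: eaa'; rewrite a'E ?e_irr.
(* Here [v] lies on a cycle of length at least 4. Choosing [v] deletes 3 vertices; without [v],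
   choosing [a] deletes 3 in total, and choosing [a'] deletes 4 since [v] is not a neighbour of
   [a']. The sum of two terms [w0 ^- 3] and one [w0 ^- 4] is at most 1 once [w0 ^+ 2 >= 2]. *)
have b1 : f (U :\: cnbh e v) <= weight U / w0 ^+ 3.
  apply: le_trans (IH _ _) _; first by apply: (Dproper v); rewrite // setU11.
  by apply: weight_setD; rewrite cnbhI // d2.
have sub1 u : (U :\ v) :\: cnbh e u = U :\: (v |: cnbh e u) by rewrite setDDl.
have b2 : f (U :\ v) <= weight U / w0 ^+ 3 + weight U / w0 ^+ 4.
  have aUv : a \in U :\ v by rewrite !inE eq_sym va aU.
  apply: (@le_trans _ _ (\sum_(u in cnbh e a :&: (U :\ v)) f ((U :\ v) :\: cnbh e u))).
    by rewrite -natr_sum ler_nat nmis_nbh.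
  have -> : cnbh e a :&: (U :\ v) = a |: [set a'].
    rewrite setDE setIA -setDE setIUl ea (setIidPl _) ?sub1set //.
    apply/setP => x; rewrite !inE; case: (altP (x =P v)) => [->|_] //=.
    by rewrite (negPf va) (negPf va').
  have aa' : a != a' by apply: contraTneq eaa' => <-; rewrite e_irr.
  rewrite big_setU1 ?inE //= big_set1 !sub1; apply: lerD.
    apply: le_trans (IH _ _) _; first by apply: (Dproper v); rewrite // setU11.
    apply: weight_setD; rewrite (setUidPr _) ?cnbhI ?d2 //.
    by rewrite sub1set !inE e_sym eva orbT.
  apply: le_trans (IH _ _) _; first by apply: (Dproper v); rewrite // setU11.
  apply: weight_setD; rewrite setIUl (setIidPl _) ?sub1set // cardsU1.
  by rewrite cnbhI // d2 // !inE vU andbT negb_or va' e_sym eva'.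
apply: (@le_trans _ _ (f (U :\ v) + f (U :\: cnbh e v))).
  by rewrite -natrD ler_nat nmis_branch.
apply: le_trans (lerD b2 b1) _.
rewrite -!mulrDr; apply: ler_piMr; first exact/ltW/weight_gt0.
have h : w0 * 2 + 1 <= w0 ^+ 4.
  have : 0 <= (w0 ^+ 2 - 2) * (w0 ^+ 2 + 1).
    by apply: mulr_ge0; rewrite ?subr_ge0 // addr_ge0 ?sqr_ge0.
  by have := sqr_ge0 (w0 - 1); nra.
have -> : (w0 ^+ 3)^-1 + (w0 ^+ 4)^-1 + (w0 ^+ 3)^-1 = (w0 * 2 + 1) / w0 ^+ 4.
  by field; rewrite gt_eqF.
by rewrite ler_pdivrMr ?exprn_gt0 // mul1r.
Qed.

End WeightedBounds.

(** The critical case is [j = 3], where (13/9)^3 is barely above 3. This supplies the hypothesis of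
    [nmis_le_weight] with a rational base. *)
Lemma natr_le_expr (R : realFieldType) (j : nat) : j%:R <= (13 / 9) ^+ j :> R.
Proof.
elim: j => [|[|[|[|j]]] IH]; rewrite ?expr0 ?ler01 ?expr1 //; do 3?[lra].
rewrite exprSr -natr1; have : (3%:R : R) <= j.+3%:R by rewrite ler_nat.
have : j.+3%:R * (13 / 9) <= (13 / 9) ^+ j.+3 * (13 / 9) :> R by apply: (ler_wpM2r _ IH); lra.
by lra.
Qed.

Lemma sum_card_nbh {T : finType} (e : rel T) (A B : {set T}) : symmetric e ->
  (\sum_(x in A) #|nbh e x :&: B| = \sum_(y in B) #|nbh e y :&: A|)%N.
Proof.
move=> e_sym.
have cE (C : {set T}) x : (#|nbh e x :&: C| = \sum_(y in C) e x y)%N.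
  rewrite -sum1_card big_mkcond [RHS]big_mkcond /=; apply: eq_bigr => y _.
  by rewrite !inE; case: (e x y); case: (y \in C).
under eq_bigr => x _ do rewrite cE; rewrite exchange_big /=.
by apply: eq_bigr => y _; rewrite cE; apply: eq_bigr => x _; rewrite e_sym.
Qed.

(* Measure and conquer: in a subgraph [e'], a vertex of degree [d >= 3] gets the
   weight [w / b ^ (d - 2)] instead of [w], and branching on such a vertex keeps
   the bound because deleting edges costs only powers of [b]. The invariant [J]
   allows to exclude configurations at the leaves of the recursion. *)
Section Potential.
Context {R : realFieldType} {T : finType} (e e' : rel T).
Hypotheses (e_sym : symmetric e) (e_irr : irreflexive e).
Hypotheses (e'_sym : symmetric e') (e'_sub : forall x y, e' x y -> e x y).
Hypothesis deg4 : forall v, (#|nbh e' v| <= 4)%N.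
Variables (w : T -> R) (w0 b : R).
Hypotheses (w0_ge1 : 1 <= w0) (w_ge : forall x, w0 <= w x) (b_ge1 : 1 <= b).
Hypothesis branch3 : b ^+ 4 / w0 + b ^+ 16 / w0 ^+ 4 <= 1.
Hypothesis branch4 : b ^+ 6 / w0 + b ^+ 22 / w0 ^+ 5 <= 1.

Definition deg_in (U : {set T}) v := #|nbh e' v :&: U|.
Definition excess (U : {set T}) := (\sum_(x in U) (deg_in U x - 2))%N.

Variable J : {set T} -> Prop.
Hypothesis J_del : forall (U : {set T}) v, v \in U -> (3 <= deg_in U v)%N -> J U -> J (U :\ v).
Hypothesis J_nbh : forall (U : {set T}) v, v \in U -> (3 <= deg_in U v)%N -> J U ->
  J (U :\: cnbh e' v).
Hypothesis J_leaf : forall (U : {set T}), J U -> (forall v, v \in U -> (deg_in U v <= 2)%N) ->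
  (nmis e U)%:R <= weight w U.

(** Besides the excess carried by [A] itself, each edge from [A] to the rest lowers the excess of
    its outer end by at most one. *)
Lemma excess_setD (U A : {set T}) : A \subset U ->
  (excess U <= excess (U :\: A)
     + \sum_(y in A) (deg_in U y - 2 + #|nbh e' y :&: (U :\: A)|))%N.
Proof.
move=> AU; rewrite big_split /= -sum_card_nbh // addnCA [X in (X <= _)%N](big_setID A) /=.
rewrite (setIidPr AU) leq_add2l -big_split /=; apply: leq_sum => x _.
suff : (deg_in U x <= deg_in (U :\: A) x + #|nbh e' x :&: A|)%N by lia.
rewrite /deg_in addnC -(cardsID A) leq_add ?subset_leq_card //.
  by apply: setSI; apply: subsetIl.
by rewrite setIDA.
Qed.

Lemma nmis_potential U : J U -> (nmis e U)%:R * b ^+ excess U <= weight w U.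
Proof.
have arith l : (3 <= l -> 6 * l - 2 = (l - 2) + 5 * l)%N by clear; lia.
have w0_gt0 : 0 < w0 by exact: lt_le_trans w0_ge1.
have b_gt0 : 0 < b by exact: lt_le_trans b_ge1.
have [n] := ubnP #|U|; elim: n U => // n IHn U; rewrite ltnS => hn JU.
have [/exists_inP[v vU dv]|] := boolP [exists v in U, 3 <= deg_in U v]%N; last first.
  rewrite negb_exists_in => /forall_inP h.
  have h2 v : v \in U -> (deg_in U v <= 2)%N by move=> /h; lia.
  rewrite (_ : excess U = 0)%N ?expr0 ?mulr1; first exact: J_leaf.
  by apply: big1 => v /h2; lia.
have d4 x : (deg_in U x <= 4)%N.
  by apply: leq_trans (deg4 x); apply/subset_leq_card/subsetIl.
pose d := deg_in U v.
have vnv : v \notin nbh e' v by rewrite inE; apply: contraFN (e_irr v); apply: e'_sub.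
have step (A : {set T}) k l : A \subset U -> v \in A -> J (U :\: A) ->
    (\sum_(y in A) (deg_in U y - 2 + #|nbh e' y :&: (U :\: A)|) <= k)%N ->
    (l <= #|A|)%N ->
    (nmis e (U :\: A))%:R * b ^+ excess U <= weight w U * (b ^+ k / w0 ^+ l).
  move=> AU vA JUA hk hl.
  have h1 : b ^+ excess U <= b ^+ excess (U :\: A) * b ^+ k.
    rewrite -exprD; apply: ler_weXn2l => //.
    by apply: leq_trans (excess_setD AU) _; rewrite leq_add2l.
  apply: le_trans (ler_wpM2l (ler0n _ _) h1) _; rewrite [leLHS]mulrA.
  rewrite [X in _ <= _ * X]mulrC [leRHS]mulrA; apply: ler_wpM2r.
    by rewrite exprn_ge0 ?ltW.
  apply: le_trans (IHn _ _ JUA) _.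
    apply: leq_trans hn; apply: proper_card; apply/properP; split; first exact: subsetDl.
    by exists v; rewrite ?vU // inE vA.
  by apply: (weight_setD w0_ge1 w_ge); rewrite (setIidPl AU).
(* Deleting [v] loses its own excess [d - 2] and at most one at each of its [d] neighbours, hence
   [2 * d - 2]. Choosing [v] loses [d - 2], and for each neighbour an excess of at most 2 and at
   most 3 further edges, hence [6 * d - 2]. For [d = 3, 4] these are the exponents 4, 16 and 6, 22
   of [branch3] and [branch4]. *)
have b1 : (nmis e (U :\ v))%:R * b ^+ excess U
    <= weight w U * (b ^+ (2 * d - 2) / w0 ^+ 1).
  apply: step; rewrite ?sub1set ?set11 ?cards1 //; first exact: J_del.
  rewrite big_set1 -/d (_ : #|_| = d).
    by rewrite mul2n -addnn addnBAC ?leqnn // (leq_trans _ dv).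
  apply: eq_card => x; rewrite !inE; case: eqP => [->|]; rewrite ?andbT //=.
  by move: vnv; rewrite inE => /negPf ->.
have b2 : (nmis e (U :\: cnbh e v))%:R * b ^+ excess U
    <= weight w U * (b ^+ (6 * d - 2) / w0 ^+ d.+1).
  (* Only the neighbours in [e'] are removed, since degrees in [e] are not controlled; by
     [nmis_mono] this can only increase the count. *)
  apply: (@le_trans _ _ ((nmis e (U :\: cnbh e' v))%:R * b ^+ excess U)).
    apply: ler_wpM2r; first by rewrite exprn_ge0 ?ltW.
    rewrite ler_nat; apply: nmis_mono => //; apply: setDS; apply: setUS.
    by apply/subsetP => x; rewrite !inE; apply: e'_sub.
  have cI : cnbh e' v :&: U = v |: (nbh e' v :&: U).
    by rewrite setIUl (setIidPl _) ?sub1set.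
  have cE : U :\: cnbh e' v = U :\: (cnbh e' v :&: U) by rewrite setDIr setDv setU0.
  have vN : v \notin nbh e' v :&: U by rewrite inE (negPf vnv).
  rewrite cE; apply: step.
  - exact: subsetIr.
  - by rewrite inE setU11.
  - by rewrite -cE; apply: J_nbh.
  - rewrite -cE cI big_setU1 //=.
    rewrite (_ : nbh e' v :&: (U :\: cnbh e' v) = set0); last first.
      by apply/setP => x; rewrite !inE; case: (e' v x); rewrite ?orbT.
    rewrite cards0 addn0 -/d.
    rewrite (arith _ dv).
    rewrite leq_add2l.
    rewrite mulnC -sum_nat_const; apply: leq_sum => y; rewrite !inE => /andP[evy yU].
    apply: (@leq_add _ _ 2 3); first by rewrite leq_subLR; exact: d4.
    rewrite -ltnS; apply: leq_trans (deg4 y); apply: proper_card; apply/properP.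
    split; first exact: subsetIl.
    by exists v; rewrite !inE ?eqxx ?andbF // e'_sym.
  - by rewrite cI cardsU1 vN.
have := nmis_branch e_sym v U; rewrite -(ler_nat R) natrD => h.
apply: le_trans (ler_wpM2r _ h) _; first by rewrite exprn_ge0 ?ltW.
rewrite mulrDl; apply: le_trans (lerD b1 b2) _; rewrite -mulrDr.
apply: ler_piMr; first exact/ltW/(weight_gt0 w0_ge1 w_ge).
have /orP[/eqP ->|/eqP ->] : (d == 3) || (d == 4) by move: dv (d4 v); rewrite -/d; case: (d) => [|[|[|[|[|]]]]].
  by rewrite expr1; exact: branch3.
by rewrite expr1; exact: branch4.
Qed.

End Potential.

(** * Regularity and removal *)

Section Regularity.
Context {R : realFieldType} {T : finType} (E : rel T).

Definition edges (A B : {set T}) : R := \sum_(x in A) \sum_(y in B) (E x y)%:R.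
Definition area (A B : {set T}) : R := #|A|%:R * #|B|%:R.
Definition density A B := edges A B / area A B.

Lemma area_ge0 A B : 0 <= area A B.
Proof. by apply: mulr_ge0. Qed.

Lemma edges_ge0 A B : 0 <= edges A B.
Proof. by apply: sumr_ge0 => x _; apply: sumr_ge0. Qed.

Lemma sum_area (A B : {set T}) (t : R) : \sum_(x in A) \sum_(y in B) t = area A B * t.
Proof.
under eq_bigr => x _ do rewrite sumr_const.
by rewrite sumr_const -mulrnA /area -natrM mulr_natl mulnC.
Qed.

Lemma edges_le_area A B : edges A B <= area A B.
Proof.
rewrite -[area A B]mulr1 -sum_area; apply: ler_sum => x _; apply: ler_sum => y _.
by rewrite lern1 leq_b1.
Qed.

Lemma edges_area0 A B : area A B = 0 -> edges A B = 0.
Proof. by move=> h; apply/eqP; rewrite eq_le edges_ge0 andbT -h edges_le_area. Qed.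

Lemma density_area A B : density A B * area A B = edges A B.
Proof.
rewrite /density; have [h|h] := eqVneq (area A B) 0; last by rewrite divfK.
by rewrite h mulr0 edges_area0.
Qed.

(** A minorant of [density A B ^+ 2 * area A B], attained at [t = density A B]. Unlike that square
    it is additive over pieces of [A] times [B]. *)
Definition tangent (t : R) A B := 2 * t * edges A B - t ^+ 2 * area A B.

Lemma tangent_density A B : tangent (density A B) A B = density A B ^+ 2 * area A B.
Proof. by rewrite /tangent -density_area; ring. Qed.

Lemma tangent_le t A B : tangent t A B <= density A B ^+ 2 * area A B.
Proof.
rewrite -subr_ge0 (_ : _ - _ = (density A B - t) ^+ 2 * area A B).
  by apply: mulr_ge0; rewrite ?sqr_ge0 ?area_ge0.
by rewrite /tangent -(density_area A B); ring.
Qed.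

Lemma tangent_sum (t : R) A B :
  tangent t A B = \sum_(x in A) \sum_(y in B) (2 * t * (E x y)%:R - t ^+ 2).
Proof.
under [RHS]eq_bigr => x _ do rewrite sumrB -mulr_sumr.
rewrite sumrB -mulr_sumr /tangent; congr (_ - _).
by rewrite sum_area mulrC.
Qed.

Section Colouring.
Context {C : finType} (c : T -> C).
Definition cell i := [set x | c x == i].
Definition energy := \sum_i \sum_j density (cell i) (cell j) ^+ 2 * area (cell i) (cell j).

Lemma sum_cells (F : T -> T -> R) :
  \sum_x \sum_y F x y = \sum_i \sum_j \sum_(x in cell i) \sum_(y in cell j) F x y.
Proof.
rewrite (partition_big c xpredT) //=; apply: eq_bigr => i _; rewrite exchange_big /=.
rewrite (partition_big c xpredT) //=; apply: eq_bigr => j _; rewrite exchange_big /=.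
by apply: eq_big => [x|x _]; rewrite ?inE //; apply: eq_bigl => y; rewrite inE.
Qed.

Lemma sum_cells_area : \sum_i \sum_j area (cell i) (cell j) = #|T|%:R ^+ 2.
Proof.
have -> : #|T|%:R ^+ 2 = \sum_(x : T) \sum_(y : T) (1 : R).
  under eq_bigr => x _ do rewrite sumr_const.
  by rewrite sumr_const -mulrnA expr2 -natrM.
rewrite sum_cells; apply: eq_bigr => i _; apply: eq_bigr => j _.
by rewrite sum_area mulr1.
Qed.

Lemma energy_le : energy <= #|T|%:R ^+ 2.
Proof.
rewrite -sum_cells_area; apply: ler_sum => i _; apply: ler_sum => j _.
apply: ler_piMl; first exact: area_ge0.
have h0 : 0 <= density (cell i) (cell j) by rewrite divr_ge0 ?edges_ge0 ?area_ge0.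
rewrite expr_le1 //; have [h|h] := eqVneq (area (cell i) (cell j)) 0.
  by rewrite /density h invr0 mulr0 ler01.
by rewrite ler_pdivrMr ?mul1r ?edges_le_area // lt_neqAle eq_sym h area_ge0.
Qed.

(* Variational form of the energy; it replaces Cauchy-Schwarz in the increment
   argument. *)
Lemma energy_ge (t : C -> C -> R) :
  \sum_x \sum_y (2 * t (c x) (c y) * (E x y)%:R - t (c x) (c y) ^+ 2) <= energy.
Proof.
rewrite sum_cells; apply: ler_sum => i _; apply: ler_sum => j _.
apply: le_trans (tangent_le (t i j) _ _); rewrite tangent_sum.
rewrite le_eqVlt; apply/orP; left; apply/eqP.
apply: eq_bigr => x; rewrite inE => /eqP ->.
by apply: eq_bigr => y; rewrite inE => /eqP ->.
Qed.

Variable eps : R.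
(** Regularity is one-sided: a pair of density at least [2 * eps] is irregular only if some large
    subpair has density below [eps]. Counting triangles needs only lower bounds on densities, and
    the gap [eps] feeds the energy increment. *)
Definition sparse i j := edges (cell i) (cell j) < 2 * eps * area (cell i) (cell j).
Definition witness i j (AB : {set T} * {set T}) :=
  [&& AB.1 \subset cell i, AB.2 \subset cell j, eps * #|cell i|%:R <= #|AB.1|%:R,
      eps * #|cell j|%:R <= #|AB.2|%:R & edges AB.1 AB.2 < eps * area AB.1 AB.2].
Definition irregular i j := ~~ sparse i j && [exists AB, witness i j AB].
Definition irregular_area := \sum_i \sum_(j | irregular i j) area (cell i) (cell j).

Definition wit i j : {set T} * {set T} :=
  if ~~ sparse i j then odflt (set0, set0) [pick AB | witness i j AB] else (set0, set0).

(** The common refinement of the cells by both sides of all witnesses: the colour records the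
    memberships of [x], and one round multiplies the number of colours by 4 ^ (#|C| ^ 2). *)
Definition refined x : C * {ffun C * C -> bool * bool} :=
  (c x, [ffun p => (x \in (wit p.1 p.2).1, x \in (wit p.1 p.2).2)]).

End Colouring.

(** In [energy_ge], use the density of the witness on the witness and the old density elsewhere. The
    gain is the squared difference of the two, at least [eps ^+ 2], times an area of at least
    [eps ^+ 2] times that of the pair. *)
Lemma energy_refined (C : finType) (c : T -> C) (eps : R) : 0 < eps ->
  energy c + eps ^+ 4 * irregular_area c eps <= energy (refined c eps).
Proof.
move=> eps0.
pose d i j := density (cell c i) (cell c j).
pose d' i j := density (wit c eps i j).1 (wit c eps i j).2.
pose tau (p q : C * {ffun C * C -> bool * bool}) : R :=
  if (p.2 (p.1, q.1)).1 && (q.2 (p.1, q.1)).2 then d' p.1 q.1 else d p.1 q.1.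
apply: le_trans (energy_ge (refined c eps) tau).
rewrite (sum_cells c) /energy /irregular_area mulr_sumr -big_split /=.
apply: ler_sum => i _.
rewrite mulr_sumr [X in _ + X]big_mkcond -big_split /=.
apply: ler_sum => j _.
set A := (wit c eps i j).1; set B := (wit c eps i j).2.
have AV : A \subset cell c i.
  rewrite /A /wit; case: ifP => _; last exact: sub0set.
  by case: pickP => [AB /and5P[]//|_] /=; apply: sub0set.
have BV : B \subset cell c j.
  rewrite /B /wit; case: ifP => _; last exact: sub0set.
  by case: pickP => [AB /and5P[]//|_] /=; apply: sub0set.
have -> : \sum_(x in cell c i) \sum_(y in cell c j)
    (2 * tau (refined c eps x) (refined c eps y) * (E x y)%:R
     - tau (refined c eps x) (refined c eps y) ^+ 2)
  = tangent (d i j) (cell c i) (cell c j) + (tangent (d' i j) A B - tangent (d i j) A B).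
  rewrite !tangent_sum -sumrB.
  have sub (D V : {set T}) (F : T -> R) : D \subset V ->
      \sum_(x in D) F x = \sum_(x in V) if x \in D then F x else 0.
    move=> DV; rewrite -big_mkcondr /=; apply: eq_bigl => x.
    by case: (boolP (x \in D)) => [/(subsetP DV) ->|]; rewrite ?andbF.
  rewrite (sub _ _ _ AV) -big_split /=; apply: eq_bigr => x; rewrite inE => /eqP cx.
  rewrite -sumrB (sub _ _ _ BV); have [xA|xA] := boolP (x \in A); last first.
    rewrite addr0; apply: eq_bigr => y; rewrite inE => /eqP cy.
    by rewrite /tau /= !ffunE cx cy /= -/A (negPf xA).
  rewrite -big_split /=; apply: eq_bigr => y; rewrite inE => /eqP cy.
  rewrite /tau /= !ffunE cx cy /= -/A -/B xA /=.
  by case: (y \in B); rewrite ?addr0 //; ring.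
rewrite tangent_density lerD2l.
have -> : tangent (d' i j) A B - tangent (d i j) A B = (d i j - d' i j) ^+ 2 * area A B.
  by rewrite /tangent -(density_area A B) -/(d' i j); ring.
case: ifP => [/andP[ns ex]|_]; last by rewrite mulr_ge0 ?sqr_ge0 ?area_ge0.
have : witness c eps i j (A, B).
  rewrite /A /B /wit ns; case: pickP => [[]//|h].
  by case/existsP: ex => AB; rewrite h.
case/and5P => /= _ _ hA hB hE.
have aV0 : 0 < area (cell c i) (cell c j).
  rewrite lt_neqAle area_ge0 andbT eq_sym; apply: contraTneq hE => h0.
  suff -> : area A B = 0 by rewrite mulr0 -leNgt edges_ge0.
  apply/eqP; rewrite eq_le area_ge0 andbT -h0.
  by apply: ler_pM => //; rewrite ler_nat subset_leq_card.
have aA : eps ^+ 2 * area (cell c i) (cell c j) <= area A B.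
  by rewrite /area expr2 mulrACA; apply: ler_pM => //; rewrite mulr_ge0 // ltW.
have aA0 : 0 < area A B by apply: lt_le_trans aA; rewrite mulr_gt0 ?exprn_gt0.
have hd : 2 * eps <= d i j by rewrite ler_pdivlMr // leNgt.
have hd' : d' i j < eps by rewrite ltr_pdivrMr.
have hdd : eps ^+ 2 <= (d i j - d' i j) ^+ 2 by rewrite ler_sqr ?nnegrE; lra.
rewrite (exprD _ 2 2) -mulrA; apply: ler_pM => //; rewrite ?exprn_ge0 ?ltW //.
by rewrite mulr_gt0 ?exprn_gt0.
Qed.

End Regularity.

(** The energy never exceeds [#|T| ^ 2], and a round that ends irregular adds [eps ^+ 5 * #|T| ^ 2],
    one factor [eps] coming from the irregular area. So the number of rounds, and with it [K],
    depends on [eps] only. *)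
Lemma regularity (R : archiRealFieldType) (eps : R) : 0 < eps ->
  exists K : nat, (0 < K)%N /\ forall (T : finType) (E : rel T),
    exists (C : finType) (c : T -> C), (#|C| <= K)%N /\
      irregular_area E c eps <= eps * #|T|%:R ^+ 2.
Proof.
move=> eps0.
have H (s : nat) : exists K : nat, (0 < K)%N /\ forall (T : finType) (E : rel T),
    exists (C : finType) (c : T -> C), (#|C| <= K)%N /\
      (irregular_area E c eps <= eps * #|T|%:R ^+ 2 \/
       s%:R * eps ^+ 5 * #|T|%:R ^+ 2 <= energy E c).
  elim: s => [|s [K [K0 IH]]].
    exists 1%N; split=> // T E; exists unit, (fun=> tt); split; first by rewrite card_unit.
    right; rewrite !mul0r; apply: sumr_ge0 => i _; apply: sumr_ge0 => j _.
    by rewrite mulr_ge0 ?sqr_ge0 ?area_ge0.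
  exists (K * 4 ^ (K * K))%N; split; first by rewrite muln_gt0 K0 expn_gt0.
  move=> T E; have [C [c [CK hc]]] := IH T E.
  have [reg|irr] := boolP (irregular_area E c eps <= eps * #|T|%:R ^+ 2).
    exists C, c; split; last by left.
    by apply: leq_trans CK _; rewrite leq_pmulr // expn_gt0.
  exists (C * {ffun C * C -> bool * bool})%type, (refined E c eps); split.
    rewrite card_prod card_ffun !card_prod !card_bool.
    by apply: leq_mul => //; apply: (@leq_pexp2l 4) => //; apply: leq_mul.
  right; case: hc => [h|hc]; first by rewrite h in irr.
  apply: le_trans (energy_refined E c eps0).
  rewrite -natr1 mulrDl mul1r mulrDl; apply: lerD => //.
  rewrite (exprD _ 4 1) -mulrA expr1; apply: ler_wpM2l; first by rewrite exprn_ge0 ?ltW.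
  by rewrite ltW // ltNge.
have e50 : 0 < eps ^+ 5 by rewrite exprn_gt0.
have [s hs] : exists s : nat, (eps ^+ 5)^-1 < s%:R.
  by exists (Num.bound (eps ^+ 5)^-1); apply: archi_boundP; rewrite invr_ge0 ltW.
have [K [K0 HK]] := H s; exists K; split=> // T E.
have [C [c [CK hc]]] := HK T E; exists C, c; split=> //.
case: hc => // hc; have := le_trans hc (energy_le E c).
rewrite -{2}[_ ^+ 2]mul1r; have [T0|T0] := eqVneq #|T| 0%N.
  move=> _; rewrite T0 expr0n /= mulr0 /irregular_area big1 // => i _; apply: big1 => j _.
  have h : #|cell c i| = 0%N by apply/eqP; rewrite -leqn0 -T0 max_card.
  by rewrite /area h mul0r.
rewrite ler_pM2r; last by rewrite exprn_gt0 // ltr0n lt0n.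
by rewrite leNgt -ltr_pdivrMr // div1r hs.
Qed.

(** * Counting and removing triangles *)

Section TriangleCounting.
Context {R : realFieldType} {T : finType} (E : rel T) {C : finType} (c : T -> C).
Variable eps : R.
Hypotheses (eps0 : 0 < eps) (eps4 : 4 * eps <= 1).

Local Notation V := (cell c).
Let regular i j := ~~ sparse E c eps i j && ~~ irregular E c eps i j.

Lemma regular_edges i j (A B : {set T}) : regular i j -> A \subset V i -> B \subset V j ->
  eps * #|V i|%:R <= #|A|%:R -> eps * #|V j|%:R <= #|B|%:R ->
  eps * area A B <= edges (R := R) E A B.
Proof.
move=> /andP[ns]; rewrite /irregular ns /= negb_exists => /forallP /(_ (A, B)) nw AV BV hA hB.
by move: nw; rewrite /witness /= AV BV hA hB /= -leNgt.
Qed.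

Definition out (x : T) j := [set y in V j | E x y].

(** Otherwise these vertices, paired with the whole of [V j], would contradict regularity. *)
Lemma card_low_degree i j : regular i j ->
  #|[set x in V i | #|out x j|%:R < eps * #|V j|%:R]|%:R <= eps * #|V i|%:R.
Proof.
move=> reg; rewrite leNgt; apply/negP => h; set A := [set x in _ | _] in h.
have AV : A \subset V i by apply/subsetP => x; rewrite inE => /andP[].
have eps1 : eps * #|V j|%:R <= #|V j|%:R by apply: ler_piMl => //; have := eps0; have := eps4; lra.
have := regular_edges reg AV (subxx _) (ltW h) eps1; rewrite leNgt => /negP; apply.
have A0 : (0 < #|A|)%N.
  by rewrite -(ltr0n R); apply: le_lt_trans h; rewrite mulr_ge0 // ltW.
rewrite /area mulrCA /edges mulr_natl -sumr_const.
have -> : \sum_(x in A) \sum_(y in V j) (E x y)%:R = \sum_(x in A) #|out x j|%:R :> R.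
  apply: eq_bigr => x _; rewrite -sum1_card natr_sum big_mkcond [RHS]big_mkcond /=.
  by apply: eq_bigr => y _; rewrite !inE; case: (c y == j) => //=; case: (E x y).
have /card_gt0P[x0 x0A] := A0.
apply: ltr_sum => [|x]; last by rewrite inE => /andP[].
by apply/hasP; exists x0; rewrite ?mem_index_enum.
Qed.

(** [E] need not be symmetric: the triangles are transitive triples, the shape formed by [x],
    [x + a], [x + a + b]. *)
Definition triangles : R := \sum_x \sum_y \sum_z (E x y && E y z && E x z)%:R.

Lemma triangles_ge i j k : regular i j -> regular i k -> regular j k ->
  eps ^+ 3 / 2 * (#|V i|%:R * #|V j|%:R * #|V k|%:R) <= triangles.
Proof.
move=> rij rik rjk.
set Lj := [set x in V i | #|out x j|%:R < eps * #|V j|%:R].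
set Lk := [set x in V i | #|out x k|%:R < eps * #|V k|%:R].
apply: (@le_trans _ _ (\sum_(x in V i :\: (Lj :|: Lk)) edges E (out x j) (out x k))); last first.
  rewrite /triangles [leLHS]big_mkcond /=; apply: ler_sum => x _.
  case: ifP => _; last by apply: sumr_ge0 => y _; apply: sumr_ge0.
  rewrite /edges [leLHS]big_mkcond /=; apply: ler_sum => y _.
  case: ifP => [|_]; last exact: sumr_ge0.
  rewrite !inE => /andP[_ exy]; rewrite [leLHS]big_mkcond /=; apply: ler_sum => z _.
  by rewrite !inE exy /=; case: ifP => [/andP[_ ->]|_]; rewrite ?andbT.
(* Each of the two low-degree sets takes at most a quarter of [V i]; this is where [4 * eps <= 1]
   enters. *)
have cG : #|V i|%:R / 2 <= #|V i :\: (Lj :|: Lk)|%:R :> R.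
  have hj : #|Lj|%:R <= eps * #|V i|%:R by exact: card_low_degree.
  have hk : #|Lk|%:R <= eps * #|V i|%:R by exact: card_low_degree.
  have : (#|V i| <= #|V i :\: (Lj :|: Lk)| + (#|Lj| + #|Lk|))%N.
    rewrite -(cardsID (Lj :|: Lk) (V i)) addnC leq_add2l.
    apply: leq_trans (subset_leq_card (subsetIr _ _)) _.
    by rewrite cardsU leq_subr.
  rewrite -(ler_nat R) !natrD => h.
  have : 0 <= (1 - 4 * eps) * #|V i|%:R by apply: mulr_ge0; rewrite // subr_ge0.
  by lra.
apply: (@le_trans _ _ (\sum_(x in V i :\: (Lj :|: Lk)) eps ^+ 3 * (#|V j|%:R * #|V k|%:R))).
  rewrite sumr_const -[leRHS]mulr_natl (_ : eps ^+ 3 / 2 * _ =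
    (#|V i|%:R / 2) * (eps ^+ 3 * (#|V j|%:R * #|V k|%:R))); last by ring.
  by apply: ler_wpM2r => //; apply: mulr_ge0; [rewrite exprn_ge0 ?ltW|apply: mulr_ge0].
apply: ler_sum => x; rewrite !inE negb_or => /andP[/andP[hj hk] xV].
rewrite xV /= -leNgt in hj; rewrite xV /= -leNgt in hk.
have sV l : out x l \subset V l by apply/subsetP => y; rewrite inE => /andP[].
apply: le_trans (regular_edges rjk (sV j) (sV k) hj hk).
rewrite /area exprS -mulrA; apply: ler_wpM2l; first exact: ltW.
by rewrite expr2 mulrACA; apply: ler_pM => //; apply: mulr_ge0 => //; apply: ltW.
Qed.

End TriangleCounting.

Lemma triangle_removal (R : archiRealFieldType) (eps : R) : 0 < eps ->
  exists2 delta : R, 0 < delta & forall (T : finType) (E : rel T),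
    triangles E <= delta * #|T|%:R ^+ 3 ->
    exists2 D : rel T, \sum_x \sum_y (D x y)%:R <= eps * #|T|%:R ^+ 2
      & forall x y z, E x y -> E y z -> E x z -> [|| D x y, D y z | D x z].
Proof.
move=> eps0; pose a : R := Num.min (eps / 5) (1 / 4).
have a0 : 0 < a by rewrite lt_min divr_gt0 // divr_gt0.
have a4 : 4 * a <= 1.
  have : a <= 1 / 4 by rewrite ge_min lexx orbT.
  lra.
have a5 : 5 * a <= eps.
  have : a <= eps / 5 by rewrite ge_min lexx.
  lra.
have [K [K0 HK]] := regularity a0.
have K0' : 0 < K%:R :> R by rewrite ltr0n.
(* Half of what one surviving triangle forces, namely [a ^+ 3 / 2] times the cube of the least size
   [a * n / K] of a cell that is not small. *)
exists (a ^+ 6 / (4 * K%:R ^+ 3)); first by rewrite divr_gt0 ?mulr_gt0 ?exprn_gt0.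
move=> T E htri; have [C [c [CK hirr]]] := HK T E.
pose n : R := #|T|%:R; rewrite -/n in htri hirr *.
have n0 : 0 <= n by [].
pose small i := #|cell c i|%:R * K%:R < a * n.
pose D x y := [|| small (c x), small (c y), irregular E c a (c x) (c y)
  | E x y && sparse E c a (c x) (c y)].
have areaE (A B : {set T}) : area (R := R) A B = \sum_(x in A) \sum_(y in B) 1.
  by rewrite sum_area mulr1.
have bsmall : \sum_(x : T) \sum_(y : T) (small (c x))%:R <= a * n ^+ 2.
  rewrite (sum_cells c (fun x y => (small (c x))%:R)).
  apply: (@le_trans _ _ (\sum_(i : C) a * n / K%:R * n)); last first.
    rewrite (_ : \sum_(i : C) _ = (a * n ^+ 2) * (#|C|%:R / K%:R)); last first.
      by rewrite sumr_const -mulr_natr; ring.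
    apply: ler_piMr; first by rewrite mulr_ge0 ?exprn_ge0 // ltW.
    by rewrite ler_pdivrMr // mul1r ler_nat.
  apply: ler_sum => i _.
  have -> : \sum_j \sum_(x in cell c i) \sum_(y in cell c j) (small (c x))%:R
      = #|cell c i|%:R * (small i)%:R * n :> R.
    rewrite exchange_big /= -mulrA mulr_natl -sumr_const; apply: eq_bigr => x.
    rewrite inE => /eqP ->; rewrite mulr_natr -sumr_const [RHS](partition_big c xpredT) //=.
    by apply: eq_bigr => j _; apply: eq_bigl => y; rewrite inE.
  apply: ler_wpM2r => //; have [hs|_] := boolP (small i); last first.
    by rewrite mulr0 divr_ge0 // mulr_ge0 // ltW.
  by rewrite mulr1 ler_pdivlMr // ltW.
exists D.
  apply: (@le_trans _ _ (\sum_x \sum_y ((small (c x))%:R + (small (c y))%:R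
     + ((irregular E c a (c x) (c y))%:R + (E x y && sparse E c a (c x) (c y))%:R)))).
    apply: ler_sum => x _; apply: ler_sum => y _; rewrite -!natrD ler_nat /D.
    by case: (small _); case: (small _); case: (irregular _ _ _ _ _); case: (_ && _).
  under eq_bigr => x _ do rewrite !big_split /=.
  rewrite !big_split /=.
  have b2 : \sum_(x : T) \sum_(y : T) (small (c y))%:R <= a * n ^+ 2 by rewrite exchange_big.
  have b3 : \sum_x \sum_y (irregular E c a (c x) (c y))%:R <= a * n ^+ 2.
    apply: le_trans hirr; rewrite (sum_cells c); apply: ler_sum => i _.
    rewrite [leRHS]big_mkcond /=; apply: ler_sum => j _.
    rewrite areaE; case: ifP => ir.
      apply: ler_sum => x; rewrite inE => /eqP ->.
      by apply: ler_sum => y; rewrite inE => /eqP ->; rewrite ir.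
    apply: sumr_le0 => x; rewrite inE => /eqP ->.
    by apply: sumr_le0 => y; rewrite inE => /eqP ->; rewrite ir.
  have b4 : \sum_x \sum_y (E x y && sparse E c a (c x) (c y))%:R <= 2 * a * n ^+ 2.
    rewrite -(sum_cells_area c) (sum_cells c) mulr_sumr; apply: ler_sum => i _.
    rewrite mulr_sumr; apply: ler_sum => j _; have [sp|nsp] := boolP (sparse E c a i j).
      apply: le_trans (ltW sp); apply: ler_sum => x _; apply: ler_sum => y _.
      by rewrite ler_nat; case: (E x y) => //=; apply: leq_b1.
    apply: (@le_trans _ _ 0); last by rewrite !mulr_ge0 // ltW.
    apply: sumr_le0 => x; rewrite inE => /eqP ->.
    by apply: sumr_le0 => y; rewrite inE => /eqP ->; rewrite (negPf nsp) andbF.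
  have : 5 * a * n ^+ 2 <= eps * n ^+ 2 by apply: ler_wpM2r; rewrite ?exprn_ge0.
  by lra.
move=> x y z exy eyz exz; apply: contraT; rewrite !negb_or exy eyz exz /=.
case/and3P => /and4P[sx sy ixy spxy] /and4P[_ sz iyz spyz] /and4P[_ _ ixz spxz].
have := @triangles_ge R T E C c a a0 a4 (c x) (c y) (c z).
rewrite ixy ixz iyz spxy spyz spxz => /(_ isT isT isT) h.
have nT : 0 < n by rewrite ltr0n; apply/card_gt0P; exists x.
have szE i : ~~ small i -> a * n / K%:R <= #|cell c i|%:R by rewrite -leNgt ler_pdivrMr.
have p0 : 0 <= a * n / K%:R by rewrite divr_ge0 // mulr_ge0 // ltW.
have : (a * n / K%:R) * (a * n / K%:R) * (a * n / K%:R)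
   <= #|cell c (c x)|%:R * #|cell c (c y)|%:R * #|cell c (c z)|%:R :> R.
  have [hx hy hz] := And3 (szE _ sx) (szE _ sy) (szE _ sz).
  by apply: ler_pM => //; [apply: mulr_ge0|apply: ler_pM].
have a30 : 0 <= a ^+ 3 / 2 by rewrite divr_ge0 // exprn_ge0 // ltW.
move=> /(ler_wpM2l a30) h2; have {}h2 := le_trans (le_trans h2 h) htri.
suff : a ^+ 6 / (4 * K%:R ^+ 3) * n ^+ 3 < a ^+ 3 / 2 * (a * n / K%:R * (a * n / K%:R) * (a * n / K%:R)).
  by rewrite ltNge h2.
rewrite -subr_gt0 (_ : _ - _ = a ^+ 6 * n ^+ 3 / (4 * K%:R ^+ 3)).
  by rewrite divr_gt0 ?mulr_gt0 ?exprn_gt0.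
by field; rewrite gt_eqF.
Qed.

(* Kral, Serra and Vena: apply triangle removal to the graph with an edge from
   [x] to [x + a] for [a] in [F]; every solution of [a + b = c] in [F] gives
   [#|G|] edge-disjoint triangles. *)
Lemma schur_removal (R : archiRealFieldType) (eps : R) : 0 < eps ->
  exists2 delta : R, 0 < delta & forall (G : finZmodType) (F : {set G}),
    #|[set p in setX F F | p.1 + p.2 \in F]|%:R <= delta * #|G|%:R ^+ 2 ->
    exists F0 : {set G}, [/\ F0 \subset F, #|F :\: F0|%:R <= eps * #|G|%:R
      & forall x y, x \in F0 -> y \in F0 -> x + y \notin F0].
Proof.
have arith (n k l m u : nat) : (3 * k < n -> 3 * l < n -> 3 * m < n ->
  u <= k + l -> u + m < n)%N by lia.
move=> eps0; have e3 : 0 < eps / 3 by rewrite divr_gt0.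
have [delta d0 H] := triangle_removal e3; exists delta => // G F hF.
have n0 : (0 < #|G|)%N by apply/card_gt0P; exists 0.
pose E := fun x y : G => y - x \in F.
have e1 (u v : G) : u + v - u = v by rewrite addrC addKr.
have /H[D hD DE] : triangles E <= delta * #|G|%:R ^+ 3.
  have -> : triangles E = #|G|%:R * #|[set p in setX F F | p.1 + p.2 \in F]|%:R :> R.
    rewrite /triangles mulr_natl -sumr_const; apply: eq_bigr => x _.
    rewrite (reindex_inj (addrI x)) /=.
    under eq_bigr => a _ do rewrite (reindex_inj (addrI (x + a))) /=.
    rewrite pair_big /= -sum1_card natr_sum [RHS]big_mkcond /=; apply: eq_bigr => -[a b] _.
    by rewrite /E !inE /= e1 -[x + a + b]addrA e1 [x + (a + b)]addrA e1; case: ifP.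
  by rewrite [_ ^+ 3]exprS mulrCA; apply: ler_wpM2l.
pose Dl a := [set x | D x (x + a)].
have shift a s : #|[set x | D (x + s) (x + s + a)]| = #|Dl a|.
  rewrite -(card_imset (Dl a) (addIr (- s))); apply: eq_card => x; rewrite inE.
  apply/idP/imsetP => [h|[y yD ->]]; last by move: yD; rewrite inE subrK.
  by exists (x + s); rewrite ?inE // addrK.
(* An element is kept if fewer than a third of its edges lie in [D]. Were [a], [b] and [a + b] all
   kept, some triangle [x], [x + a], [x + a + b] would avoid [D]. The threshold of one third is the
   reason for [eps / 3]. *)
pose F0 := [set a in F | 3 * #|Dl a| < #|G|]%N.
exists F0; split.
- by apply/subsetP => a; rewrite inE => /andP[].
- have hs : \sum_a #|Dl a|%:R <= eps / 3 * #|G|%:R ^+ 2 :> R.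
    apply: le_trans hD; under [leRHS]eq_bigr => x _ do rewrite (reindex_inj (addrI x)) /=.
    rewrite [leRHS]exchange_big /=; apply: ler_sum => a _.
    rewrite -sum1_card natr_sum big_mkcond /=; apply: ler_sum => x _.
    by rewrite inE; case: (D _ _).
  have n0' : 0 < #|G|%:R :> R by rewrite ltr0n.
  rewrite -(ler_pM2r n0') -mulrA -expr2.
  apply: (@le_trans _ _ (\sum_(a in F :\: F0) 3 * #|Dl a|%:R)).
    rewrite mulr_natl -sumr_const; apply: ler_sum => a.
    rewrite !inE negb_and -leqNgt => /andP[/orP[/negPf ->//|h] _].
    by rewrite -natrM ler_nat.
  rewrite -mulr_sumr; apply: (@le_trans _ _ (3 * \sum_a #|Dl a|%:R)); last by lra.
  by apply: ler_wpM2l => //; rewrite [leLHS]big_mkcond /=; apply: ler_sum => a _; case: ifP.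
move=> a b; rewrite !inE => /andP[aF ha] /andP[bF hb]; apply/negP => /andP[cF hc].
have : [set: G] \subset (Dl a :|: [set x | D (x + a) (x + a + b)]) :|: Dl (a + b).
  apply/subsetP => x _; rewrite !inE addrA.
  have := DE x (x + a) (x + a + b); rewrite /E.
  rewrite !e1 -[x + a + b]addrA e1 addrA aF bF cF.
  by move=> /(_ isT isT isT) /or3P[] ->; rewrite ?orbT.
move=> /subset_leq_card; rewrite cardsT => h.
have := leq_trans h (leq_card_setU _ _); rewrite leqNgt => /negP; apply.
apply: (arith _ _ _ _ _ ha hb hc); rewrite -(shift b a); exact: leq_card_setU.
Qed.

(** * Link graphs and containers *)

Lemma distinct_schur_tripleC (G : finZmodType) (x y z : G) :
  distinct_schur_triple x y z = distinct_schur_triple y x z.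
Proof.
rewrite /distinct_schur_triple addrC [y == x]eq_sym.
by case: (x == y); case: (x == z); case: (y == z); rewrite ?andbF.
Qed.

Lemma distinct_sum_freeP (G : finZmodType) (S : {set G}) :
  reflect (forall x y z, x \in S -> y \in S -> z \in S -> ~~ distinct_schur_triple x y z)
    (distinct_sum_free S).
Proof.
apply: (iffP forall_inP) => [h x y z xS yS zS|h x xS].
  exact: (forall_inP (forall_inP (h x xS) y yS)).
by apply/forall_inP => y yS; apply/forall_inP => z; apply: h.
Qed.

Section Link.
Context {G : finZmodType}.
Implicit Types (S M F : {set G}) (x y z : G).

Definition link S : rel G := fun x y =>
  [exists s in S, [|| distinct_schur_triple x y s, distinct_schur_triple x s y
    | distinct_schur_triple y s x]].

Lemma linkE S x y :
  link S x y = (x != y) && [exists s in S, [&& s != x, s != y & [|| x + y == s, x + s == y | y + s == x]]].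
Proof.
apply/exists_inP/andP => [[s sS h]|[xy /exists_inP[s sS h]]].
  suff [xy h'] : x != y /\ [&& s != x, s != y & [|| x + y == s, x + s == y | y + s == x]].
    by split=> //; apply/exists_inP; exists s.
  case/or3P: h => /and4P[e1 n1 n2 n3]; rewrite e1 ?orbT;
    by rewrite ?n1 ?n2 ?n3 ?[s == x]eq_sym ?[s == y]eq_sym ?n1 ?n2 ?n3 // eq_sym.
exists s => //; case/and3P: h => sx sy; rewrite /distinct_schur_triple.
by rewrite xy [y == x]eq_sym xy [x == s]eq_sym [y == s]eq_sym sx sy !andbT.
Qed.

Lemma link_sym S : symmetric (link S).
Proof.
move=> x y; rewrite !linkE eq_sym; congr (_ && _); apply: eq_existsb_in => s _.
by rewrite addrC [RHS]andbCA; congr [&& _, _ & _]; rewrite [(x + s == y) || _]orbC.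
Qed.

Lemma link_irr S : irreflexive (link S).
Proof. by move=> x; rewrite linkE eqxx. Qed.

Lemma link_sumfree M S x y : distinct_sum_free M -> S \subset M ->
  x \in M -> y \in M -> ~~ link S x y.
Proof.
move=> /distinct_sum_freeP sfM /subsetP SM xM yM; apply/negP => /exists_inP[s /SM sM].
by case/or3P; apply/negP; apply: sfM.
Qed.

(* Outside [F0], such an M is known, and inside [F0] it is a maximal independent
   set of the link graph: a triple witnessing that [x] cannot be added to M has
   exactly one of its two other elements in [F0]. *)
Lemma card_max_le_nmis S F0 :
  (forall x y z, x \in F0 -> y \in F0 -> z \in F0 -> ~~ distinct_schur_triple x y z) ->
  (#|[set M in max_distinct_sum_free G | M :\: F0 == S]| <= nmis (link S) F0)%N.
Proof.
move=> sfF0.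
(* A point forming a triple with two elements of [S] is excluded from M without any link edge to
   account for it. The count is therefore made on the other points of [F0], and [nmis_mono] returns
   to [F0]. *)
pose blocked x := [exists s in S, exists t in S,
  distinct_schur_triple x s t || distinct_schur_triple s t x].
pose U := [set x in F0 | ~~ blocked x].
have UF0 : U \subset F0 by apply/subsetP => x; rewrite inE => /andP[].
apply: leq_trans (nmis_mono (@link_sym S) (@link_irr S) UF0).
pose f M := M :&: F0.
rewrite -(@card_in_imset _ _ f); last first.
  move=> M N; rewrite !inE => /andP[_ /eqP MS] /andP[_ /eqP NS] eMN.
  by rewrite -(setID M F0) -(setID N F0) MS NS -/(f M) eMN.
apply/subset_leq_card/subsetP => _ /imsetP[M + ->]; rewrite !inE.
case/andP => /maxsetP[sfM maxM] /eqP MS.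
have SM : S \subset M by rewrite -MS subsetDl.
have sfM' := distinct_sum_freeP _ sfM.
apply/misP; split.
- apply/subsetP => x /setIP[xM xF]; rewrite inE xF /=; apply/negP.
  case/exists_inP => s sS /exists_inP[t tS].
  move/subsetP in SM; have sM := SM s sS; have tM := SM t tS.
  by case/orP; apply/negP; apply: sfM'.
- by move=> x y /setIP[xM _] /setIP[yM _]; apply: link_sumfree sfM SM xM yM.
move=> x; rewrite !inE => /andP[xF nb]; rewrite xF andbT => xM.
have inS y : y \in M -> y \notin F0 -> y \in S by rewrite -MS inE => -> ->.
have nsf : ~~ distinct_sum_free (x |: M).
  apply: contra xM => /maxM /(_ (subsetUr _ _)) <-; exact: setU11.
have key y z : y \in M -> z \in M -> distinct_schur_triple x y z || distinct_schur_triple y z x ->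
    exists2 y0, y0 \in f M & link S x y0.
  move=> yM zM h; have [yF|yF] := boolP (y \in F0); have [zF|zF] := boolP (z \in F0).
  - by case/orP: h => h; [have := sfF0 _ _ _ xF yF zF|have := sfF0 _ _ _ yF zF xF]; rewrite h.
  - exists y; rewrite ?inE ?yM //; apply/exists_inP; exists z; rewrite ?inS //.
    by case/orP: h => ->; rewrite ?orbT.
  - exists z; rewrite ?inE ?zM //; apply/exists_inP; exists y; rewrite ?inS //.
    by rewrite (distinct_schur_tripleC z); case/orP: h => ->; rewrite ?orbT.
  - case/negP: nb; apply/exists_inP; exists y; rewrite ?inS //.
    by apply/exists_inP; exists z; rewrite ?inS.
case/forall_inPn: nsf => a; rewrite inE => aM /forall_inPn[b bM] /forall_inPn[c cM].
move=> /negPn abc; have /and4P[_ ab ac bc] := abc; rewrite !inE in aM bM cM.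
have [ax|ax] := eqVneq a x.
  rewrite ax in abc ab ac; apply: (key b c); rewrite ?abc //.
    by move: bM; rewrite eq_sym (negPf ab).
  by move: cM; rewrite eq_sym (negPf ac).
rewrite (negPf ax) /= in aM; have [bx|bx] := eqVneq b x.
  rewrite bx in abc bc; apply: (key a c) => //; last by rewrite distinct_schur_tripleC abc.
  by move: cM; rewrite eq_sym (negPf bc).
rewrite (negPf bx) /= in bM; have [cx|cx] := eqVneq c x.
  by rewrite cx in abc; apply: (key a b) => //; rewrite abc orbT.
by rewrite (negPf cx) /= in cM; have := sfM' _ _ _ aM bM cM; rewrite abc.
Qed.

End Link.

(** * Growth estimates and containers for graphs *)

Lemma bernoulli_ge (R : realFieldType) (a : R) n : 0 <= a -> 1 + a *+ n <= (1 + a) ^+ n.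
Proof.
move=> a0; elim: n => [|n IH]; first by rewrite mulr0n addr0 expr0.
rewrite exprSr mulrDr mulr1 mulrS.
have : 1 <= (1 + a) ^+ n by apply: exprn_ege1; lra.
move=> h; have : a <= (1 + a) ^+ n * a by apply: ler_peMl.
lra.
Qed.

(** Splits a growth rate [c] into two equal shares whenever two subexponential factors have to be
    accommodated. *)
Lemma sqrt_gt1 (R : realFieldType) (c : R) : 1 < c -> exists2 d : R, 1 < d & d ^+ 2 <= c.
Proof.
move=> c1; pose a := Num.min 1 ((c - 1) / 3).
have a0 : 0 < a by rewrite lt_min ltr01 divr_gt0 ?subr_gt0.
have a1 : a <= 1 by rewrite ge_min lexx.
have a3 : a <= (c - 1) / 3 by rewrite ge_min lexx orbT.
exists (1 + a); first lra.
by rewrite expr2; nra.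
Qed.

(** The square of Bernoulli's bound is quadratic in [n] and beats [n + 1]; each further factor
    [n + 1] is paid by another share of [c]. The factor 2 makes room for the two families of
    [container_step]. *)
Lemma poly_le_exp (R : archiRealFieldType) K (c : R) : 1 < c ->
  exists N : nat, forall n : nat, (N <= n)%N -> (2 * n.+1 ^ K)%:R <= c ^+ n.
Proof.
have lin (d : R) : 1 < d -> exists N : nat, forall n, (N <= n)%N -> n.+1%:R <= (d ^+ 2) ^+ n.
  move=> d1; pose a := d - 1; have a0 : 0 < a by rewrite subr_gt0.
  exists (Num.bound (2 / a ^+ 2)).+1 => n hn.
  have hb : 2 / a ^+ 2 < n%:R.
    apply: lt_le_trans (archi_boundP _) _; first by rewrite divr_ge0 ?exprn_ge0 ?ltW.
    by rewrite ler_nat ltnW.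
  have n1 : 1 <= n%:R :> R by rewrite (ler_nat _ 1); apply: leq_trans hn.
  have h := @bernoulli_ge _ a n (ltW a0); rewrite -[_ *+ _]mulr_natr (_ : 1 + a = d) in h; last by rewrite /a; ring.
  rewrite exprAC; apply: (@le_trans _ _ ((1 + a * n%:R) ^+ 2)); last first.
    by rewrite ler_sqr ?nnegrE //; [apply: addr_ge0 => //; apply: mulr_ge0 => //; apply: ltW|apply: exprn_ge0; lra].
  rewrite ltr_pdivrMr ?exprn_gt0 // in hb.
  have h2 : 2 * n%:R <= n%:R * a ^+ 2 * n%:R by apply: ler_wpM2r => //; apply: ltW.
  rewrite -natr1 sqrrD; have : 0 <= a * n%:R by rewrite mulr_ge0 // ltW.
  by rewrite exprMn; lra.
elim: K c => [|K IH] c c1.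
  have [d d1 dc] := sqrt_gt1 c1; have [N HN] := lin d d1.
  exists (maxn N 1) => n; rewrite geq_max => /andP[hN n1]; rewrite expn0 muln1.
  apply: (@le_trans _ _ n.+1%:R); first by rewrite ler_nat.
  by apply: le_trans (HN n hN) _; apply: lerXn2r; rewrite ?nnegrE ?exprn_ge0 //; lra.
have [d d1 dc] := sqrt_gt1 c1; have [f f1 fd] := sqrt_gt1 d1.
have [N HN] := lin f f1; have [N' HN'] := IH d d1.
exists (maxn N N') => n; rewrite geq_max => /andP[hN hN'].
rewrite expnSr mulnA natrM; apply: (@le_trans _ _ (d ^+ n * d ^+ n)).
  apply: ler_pM => //; first exact: HN'.
  apply: le_trans (HN n hN) _; apply: lerXn2r; rewrite ?nnegrE ?exprn_ge0 //; lra.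
rewrite -exprMn; apply: lerXn2r; rewrite ?nnegrE -?expr2 //; [exact: sqr_ge0|lra].
Qed.

Lemma small_sets (T : finType) k : exists2 S : {set {set T}}, (#|S| <= #|T|.+1 ^ k)%N
  & forall A : {set T}, (#|A| <= k)%N -> A \in S.
Proof.
elim: k => [|k [S cS hS]].
  exists [set set0]; first by rewrite cards1.
  by move=> A; rewrite leqn0 cards_eq0 => /eqP ->; rewrite set11.
pose f (x : option T) (A : {set T}) := if x is Some y then y |: A else A.
exists [set f x A | x in [set: option T], A in S].
  rewrite curry_imset2X; apply: leq_trans (leq_imset_card _ _) _.
  by rewrite cardsX cardsT card_option expnS leq_mul.
move=> A cA; have [->|[x xA]] := set_0Vmem A.
  by apply/imset2P; exists None set0; rewrite ?inE // hS // cards0.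
apply/imset2P; exists (Some x) (A :\ x); rewrite ?inE //=; last by rewrite setD1K.
by apply: hS; rewrite -ltnS; move: cA; rewrite (cardsD1 x) xA.
Qed.

(** Branch on a vertex [v] with at least [theta] neighbours: an independent set misses [v] or misses
    all of them. The condition on [c] is the recursion for the number of leaves, and in a leaf all
    degrees are below [theta]. *)
Lemma graph_container (R : realFieldType) (c : R) (theta : nat) (T : finType) (e : rel T) :
  1 <= c -> (0 < theta)%N -> 1 + c ^+ (theta - 1) <= c ^+ theta -> symmetric e -> 
  forall V : {set T}, exists L : {set {set T}}, [/\ #|L|%:R <= c ^+ #|V|,
    forall A, A \in L -> forall x, x \in A -> (#|nbh e x :&: A| < theta)%N
  & forall I : {set T}, I \subset V -> indep e I -> exists2 A, A \in L & I \subset A].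
Proof.
move=> c1 th0 hc e_sym V; have [n] := ubnP #|V|; elim: n V => // n IHn V; rewrite ltnS => hn.
have [/exists_inP[v vV dv]|] := boolP [exists v in V, theta <= #|nbh e v :&: V|]%N; last first.
  rewrite negb_exists_in => /forall_inP h; exists [set V]; split.
  - by rewrite cards1 exprn_ege1.
  - by move=> A /set1P -> x /h; rewrite -ltnNge.
  - by move=> I IV _; exists V; rewrite ?set11.
have c1V : (#|V :\ v|.+1 = #|V|)%N by rewrite [RHS](cardsD1 v) vV.
have c2V : (#|V :\: nbh e v| + theta <= #|V|)%N.
  by rewrite -(cardsID (nbh e v) V) addnC leq_add2r setIC.
have [|L1 [cL1 dL1 iL1]] := IHn (V :\ v); first by rewrite c1V.
have [|L2 [cL2 dL2 iL2]] := IHn (V :\: nbh e v).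
  by apply: leq_trans hn; apply: leq_trans c2V; rewrite -addn1 leq_add2l.
exists (L1 :|: L2); split.
- apply: (@le_trans _ _ (c ^+ #|V :\ v| + c ^+ #|V :\: nbh e v|)).
    apply: le_trans (lerD cL1 cL2); rewrite -natrD ler_nat; exact: leq_card_setU.
  have hV : (theta <= #|V|)%N by apply: leq_trans c2V; rewrite leq_addl.
  have -> : c ^+ #|V| = c ^+ (#|V| - theta) * c ^+ theta by rewrite -exprD subnK.
  apply: le_trans (ler_wpM2l _ hc); last by rewrite exprn_ge0 //; lra.
  rewrite mulrDr mulr1 addrC; apply: lerD; first by apply: ler_weXn2l => //; rewrite -(leq_add2r theta) subnK.
  rewrite -exprD; apply: ler_weXn2l => //; move: c1V hV th0.
  by case: (theta) => // t <- ?; rewrite subSS subSS subn0 subnK.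
- by move=> A; rewrite inE => /orP[/dL1|/dL2].
move=> I IV iI; have [vI|vI] := boolP (v \in I); last first.
  have [|//|A AL IA] := iL1 I; last by exists A; rewrite // inE AL.
  by rewrite subsetD1 IV.
have [|//|A AL IA] := iL2 I; last by exists A; rewrite // inE AL orbT.
rewrite subsetD IV; apply/pred0P => x /=; apply/andP => -[xI]; rewrite inE.
by apply/negP; apply: (indepP _ _ iI).
Qed.

Lemma theta_exists (R : archiRealFieldType) (c : R) : 1 < c ->
  exists2 theta : nat, (0 < theta)%N & 1 + c ^+ (theta - 1) <= c ^+ theta.
Proof.
move=> c1; pose a := c - 1; have a0 : 0 < a by rewrite subr_gt0.
have [m hm] : exists m : nat, 1 / a ^+ 2 < m%:R.
  by eexists; apply: archi_boundP; rewrite divr_ge0 ?exprn_ge0 ?ltW.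
exists m.+1 => //; rewrite subn1 /=.
have := @bernoulli_ge _ a m (ltW a0); rewrite (_ : 1 + a = c); last by rewrite /a; ring.
rewrite -[_ *+ _]mulr_natr [c ^+ m.+1]exprS => h.
rewrite ltr_pdivrMr ?exprn_gt0 // in hm.
have h2 : a * (1 + a * m%:R) <= a * c ^+ m by rewrite ler_pM2l.
have -> : c * c ^+ m = c ^+ m + a * c ^+ m by rewrite /a; ring.
by move: hm h2; rewrite expr2; lra.
Qed.

(** * Containers for distinct sum-free sets *)

Section Containers.
Context {R : archiRealFieldType} {G : finZmodType}.
Implicit Types (S M F V : {set G}) (x y z : G).

Definition schur_pairs F : nat := #|[set p in setX F F | p.1 + p.2 \in F]|.
Definition link_degree V z : nat := \sum_(x in V) #|nbh (link [set z]) x :&: V|.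

Lemma card_nbhI (T : finType) (e : rel T) (B : {set T}) (x : T) :
  (#|nbh e x :&: B| = \sum_(y in B) e x y)%N.
Proof.
rewrite -sum1_card big_mkcond [RHS]big_mkcond /=; apply: eq_bigr => y _.
by rewrite !inE; case: (e x y); case: (y \in B).
Qed.

(** The first term covers the pairs with sum in [S] and the degenerate ones with [x = y], [x = 0] or
    [y = 0]. Any other pair is an edge of the link graph of its sum, which lies in [V :\: Z]. *)
Lemma schur_pairs_le V (Z : {set G}) S : S \subset V -> Z \subset V ->
  (schur_pairs ((V :\: Z) :|: S) <= (#|S| + 3) * #|G| + \sum_(z in V :\: Z) link_degree V z)%N.
Proof.
move=> SV ZV; set F := _ :|: S.
have FV x : x \in F -> x \in V by rewrite !inE => /orP[/andP[]//|/(subsetP SV)].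
pose cnt (x y : G) : nat := (((x + y)%R \in S) + (x == y) + (x == 0%R) + (y == 0%R)
   + \sum_(z in V :\: Z) ((x \in V) && (y \in V) && link [set z] x y))%N.
apply: (@leq_trans (\sum_x \sum_y cnt x y)%N).
  rewrite /schur_pairs -sum1_card pair_big /= big_mkcond /=; apply: leq_sum => -[x y] _ /=.
  rewrite /cnt !inE /=; case: ifP => // /andP[/andP[xF yF] xyF].
  have [//|xyS] := boolP (x + y \in S); have [//|xy] := eqVneq x y.
  have [//|x0] := eqVneq x 0; have [//|y0] := eqVneq y 0; rewrite /= !add0n.
  rewrite (negPf xyS) orbF in xyF.
  rewrite (bigD1 (x + y)) /= ?inE ?xyF // !FV ?inE //=.
  suff -> : link [set x + y] x y by [].
  apply/exists_inP; exists (x + y); rewrite ?set11 // /distinct_schur_triple eqxx xy /=.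
  rewrite -{1}[x]addr0 (inj_eq (addrI x)) [0 == y]eq_sym y0 /=.
  by rewrite -{1}[y]add0r (inj_eq (addIr y)) [0 == x]eq_sym x0.
rewrite /cnt; under eq_bigr => x _ do rewrite !big_split /=.
rewrite !big_split /=.
have cE (A : {set G}) : (\sum_y (y \in A) = #|A|)%N by rewrite -sum1_card [RHS]big_mkcond.
have c1 x : (\sum_y (y == x) = 1)%N.
  by under eq_bigr => y _ do rewrite -in_set1; rewrite cE cards1.
have cG (f : G -> nat) k : (forall x, f x = k) -> (\sum_x f x = k * #|G|)%N.
  by move=> h; under eq_bigr => x _ do rewrite h; rewrite sum_nat_const mulnC.
have e1 : (\sum_(x : G) \sum_(y : G) ((x + y)%R \in S) = #|S| * #|G|)%N.
  apply: cG => x; rewrite -[RHS]cE [RHS](reindex_inj (addrI x)) /=.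
  by apply: eq_bigr => y _.
have e2 : (\sum_(x : G) \sum_y (x == y) = 1 * #|G|)%N.
  by apply: cG => x; under eq_bigr => y _ do rewrite eq_sym; apply: c1.
have e3 : (\sum_(x : G) \sum_(y : G) (x == 0%R) = 1 * #|G|)%N.
  by rewrite exchange_big; apply: cG => x; apply: c1.
have e4 : (\sum_(x : G) \sum_(y : G) (y == 0%R) = 1 * #|G|)%N by apply: cG => x; apply: c1.
rewrite e1 e2 e3 e4 -!mulnDl -!addnA leq_add2l.
under eq_bigr => x _ do rewrite exchange_big /=.
rewrite exchange_big /=; apply: leq_sum => z _; rewrite /link_degree [X in (_ <= X)%N]big_mkcond /=.
apply: leq_sum => x _; case: (x \in V) => /=; last by rewrite big1.
rewrite card_nbhI [X in (_ <= X)%N]big_mkcond /=; apply: leq_sum => y _.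
by case: (y \in V).
Qed.

Lemma sum_link1_le S x y : (\sum_(z in S) link [set z] x y <= 3 * link S x y)%N.
Proof.
have [l|nl] := boolP (link S x y); last first.
  rewrite big1 // => z zS; apply/eqP; rewrite eqb0; apply: contra nl.
  case/exists_inP => s /set1P -> h; apply/exists_inP; by exists z.
rewrite muln1 -big_mkcondr sum1_card /=.
apply: (@leq_trans #|[set x + y; y - x; x - y]|); last first.
  by apply: leq_trans (leq_card_setU _ _) _; rewrite cards1 addn1 ltnS cards2; case: (_ != _).
apply/subset_leq_card/subsetP => z; rewrite -topredE /= => /andP[_].
rewrite linkE => /andP[_ /exists_inP[s /set1P -> /and3P[_ _]]]; rewrite !inE.
case/or3P => /eqP h; rewrite -h ?eqxx // 1?[x + z]addrC 1?[y + z]addrC addrK eqxx ?orbT //.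
Qed.

Lemma card_nbh_link S x : (#|nbh (link S) x| <= 3 * #|S|)%N.
Proof.
apply: (@leq_trans #|(fun s => s - x) @: S :|: (fun s => s + x) @: S :|: (fun s => x - s) @: S|).
  apply/subset_leq_card/subsetP => y; rewrite !inE linkE => /andP[_ /exists_inP[s sS /and3P[_ _]]].
  case/or3P => /eqP h; apply/orP; [left; apply/orP; left|left; apply/orP; right|right];
    apply/imsetP; exists s => //; rewrite -h.
  - by rewrite addrC addKr.
  - by rewrite addrC.
  - by rewrite addrK.
rewrite mulSn mul2n -addnn addnA; apply: leq_trans (leq_card_setU _ _) _.
by apply: leq_add (leq_imset_card _ _); apply: leq_trans (leq_card_setU _ _) _; apply: leq_add; apply: leq_imset_card.
Qed.

(** Count the degree sum of the link graph of [T] on [V]. It is at least a third of the sum of the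
    link degrees, an edge having at most three labels. [A] contributes at most [theta * #|G|], and
    each vertex outside [A] at most twice the maximal degree [3 * #|T|]. *)
Lemma link_container_shrinks V (A T : {set G}) (delta theta : R) :
  A \subset V -> T \subset V -> (0 < #|T|)%N -> 
  (forall z, z \in T -> delta * #|G|%:R <= (link_degree V z)%:R) ->
  (forall x, x \in A -> #|nbh (link T) x :&: A|%:R <= theta) ->
  6 * theta <= delta * #|T|%:R -> 0 <= theta ->
  #|A|%:R <= #|V|%:R - delta / 36 * #|G|%:R.
Proof.
move=> AV TV T0 hT hA htheta theta0.
pose D := (\sum_(x in V) #|nbh (link T) x :&: V|)%N.
have lo : #|T|%:R * (delta * #|G|%:R) <= 3 * D%:R.
  apply: (@le_trans _ _ (\sum_(z in T) link_degree V z)%:R).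
    by rewrite mulr_natl -sumr_const natr_sum; apply: ler_sum.
  rewrite -natrM ler_nat /link_degree exchange_big /= /D big_distrr /=.
  apply: leq_sum => x _; under eq_bigr => z _ do rewrite card_nbhI.
  by rewrite exchange_big /= card_nbhI big_distrr /=; apply: leq_sum => y _; apply: sum_link1_le.
have hi : D%:R <= theta * #|G|%:R + 2 * (3 * #|T|%:R * #|V :\: A|%:R).
  have : (D <= \sum_(x in A) #|nbh (link T) x :&: A|
      + 2 * (\sum_(x in V :\: A) #|nbh (link T) x :&: V|))%N.
    rewrite /D (big_setID A) /= (setIidPr AV) mul2n -addnn addnA leq_add2r.
    rewrite [X in (_ <= _ + X)%N]sum_card_nbh; last exact: link_sym.
    rewrite [X in (_ <= _ + X)%N](big_setID A) /= (setIidPr AV) addnA.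
    apply: leq_trans (leq_addr _ _); rewrite -big_split /=; apply: leq_sum => x _.
    rewrite -(cardsID A (nbh (link T) x :&: V)) leq_add ?subset_leq_card //.
      by apply/subsetP => y; rewrite !inE => /andP[/andP[-> _] ->].
    by apply/subsetP => y; rewrite !inE => /and3P[-> -> ->].
  rewrite -(ler_nat R) natrD natrM => h; apply: le_trans h _; apply: lerD.
    rewrite natr_sum; apply: (@le_trans _ _ (\sum_(x in A) theta)); first exact: ler_sum.
    rewrite sumr_const -[leLHS]mulr_natr; apply: ler_wpM2l => //.
    by rewrite ler_nat max_card.
  apply: ler_wpM2l => //; rewrite natr_sum.
  apply: (@le_trans _ _ (\sum_(x in V :\: A) 3 * #|T|%:R)).
    apply: ler_sum => x _; rewrite -natrM ler_nat; apply: leq_trans (card_nbh_link T x).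
    exact/subset_leq_card/subsetIl.
  by rewrite sumr_const -[leLHS]mulr_natr.
have cV : #|V|%:R = #|A|%:R + #|V :\: A|%:R :> R.
  by rewrite -natrD -(cardsID A V) (setIidPr AV).
have T0' : 0 < #|T|%:R :> R by rewrite ltr0n.
have n0 : 0 <= #|G|%:R :> R by [].
suff : #|T|%:R * (delta / 36 * #|G|%:R) <= #|T|%:R * #|V :\: A|%:R :> R.
  by rewrite ler_pM2l // cV; lra.
have : 6 * theta * #|G|%:R <= delta * #|T|%:R * #|G|%:R by apply: ler_wpM2r.
lra.
Qed.

End Containers.

Lemma exists_subset_card (T : finType) (A : {set T}) k : (k <= #|A|)%N ->
  exists2 B : {set T}, B \subset A & #|B| = k.
Proof.
case/card_geqP => s [us <- sA]; exists [set x in s].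
  by apply/subsetP => x; rewrite inE => /sA.
by rewrite cardsE; apply/card_uniqP.
Qed.

Lemma card_bigcup_le (R : numDomainType) (I T : finType) (A : {set I}) (L : I -> {set T}) (k : R) :
  (forall i, i \in A -> #|L i|%:R <= k) -> #|\bigcup_(i in A) L i|%:R <= #|A|%:R * k.
Proof.
move=> h; apply: (@le_trans _ _ (\sum_(i in A) #|L i|%:R)).
  rewrite -natr_sum ler_nat; elim/big_rec2: _ => [|i m B _ IH]; first by rewrite cards0.
  by apply: leq_trans (leq_card_setU _ _) _; rewrite leq_add2l.
by rewrite mulr_natl -sumr_const; apply: ler_sum.
Qed.

(* If [M] contains [K] elements of large link degree, their link graph on [V] is
   dense of bounded degree, so that its containers miss a positive proportion of
   [V]; otherwise these elements of [M] can be revealed one by one. *)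
Lemma container_step (R : archiRealFieldType) (delta c : R) : 0 < delta -> 1 < c ->
  exists N : nat, forall G : finZmodType, (N <= #|G|)%N -> forall V : {set G},
  exists L : {set {set G}}, [/\ #|L|%:R <= c ^+ #|G|,
    forall F, F \in L -> (schur_pairs F)%:R <= 2 * delta * #|G|%:R ^+ 2
      \/ #|F|%:R <= #|V|%:R - delta / 36 * #|G|%:R
  & forall M : {set G}, M \subset V -> distinct_sum_free M ->
      exists2 F, F \in L & M \subset F].
Proof.
move=> delta0 c1; have [d d1 dc] := sqrt_gt1 c1.
have [theta th0 hth] := theta_exists d1.
(* With [K] elements of large link degree the link graph is so dense that a vertex set on which all
   degrees stay below [theta] must miss part of [V]. *)
have [K [K0 hK]] : exists K : nat, (0 < K)%N /\ 6 * theta%:R <= delta * K%:R.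
  have h : 0 <= 6 * theta%:R / delta by rewrite divr_ge0 ?mulr_ge0 // ltW.
  have := archi_boundP h; set b := Num.bound _ => hb; exists b.+1; split=> //.
  rewrite [leRHS]mulrC -ler_pdivrMr //; apply: le_trans (ltW hb) _.
  by rewrite ler_nat.
have [N1 HN1] := poly_le_exp K d1.
have [N2 HN2] : exists N2 : nat, (K + 3)%:R / delta < N2%:R.
  by eexists; apply: archi_boundP; rewrite divr_ge0 // ltW.
exists (maxn N1 N2) => G; rewrite geq_max => /andP[hN1 hN2] V.
have {}HN1 := HN1 _ hN1; set n := #|G| in hN1 hN2 HN1 *.
have {}HN2 : (K + 3)%:R <= delta * n%:R.
  rewrite mulrC -ler_pdivrMr //; apply: le_trans (ltW HN2) _; by rewrite ler_nat.
pose Z := [set z in V | delta * n%:R <= (link_degree V z)%:R].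
have ZV : Z \subset V by apply/subsetP => z; rewrite inE => /andP[].
have [Sm cSm hSm] := small_sets G K.
have HS (S : {set G}) : exists L : {set {set G}},
   [/\ #|L|%:R <= d ^+ #|V|,
    forall A, A \in L -> A \subset V /\ forall x, x \in A -> (#|nbh (link S) x :&: A| < theta)%N
  & forall I : {set G}, I \subset V -> indep (link S) I -> exists2 A, A \in L & I \subset A].
  have [L [cL dL iL]] := graph_container (ltW d1) th0 hth (@link_sym G S) V.
  exists [set A :&: V | A in L]; split.
  - by apply: le_trans cL; rewrite ler_nat leq_imset_card.
  - move=> _ /imsetP[A AL ->]; split=> [|x /setIP[xA _]]; first exact: subsetIr.
    apply: leq_ltn_trans (dL A AL x xA); apply/subset_leq_card/setIS/subsetIl.
  - move=> I IV iI; have [A AL IA] := iL I IV iI.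
    by exists (A :&: V); [exact: imset_f|rewrite subsetI IA].
have [L HL] := fin_all_exists HS.
exists ([set (V :\: Z) :|: (S :&: V) | S in [set S in Sm | #|S| <= K]%N]
   :|: \bigcup_(S in [set S in Sm | (S \subset Z) && (#|S| == K)]) L S).
have cSm' (P : pred {set G}) : (#|[set S in Sm | P S]| <= n.+1 ^ K)%N.
  apply: leq_trans cSm; apply/subset_leq_card/subsetP => S.
  by rewrite inE => /andP[].
split.
- apply: (@le_trans _ _ ((n.+1 ^ K)%:R + (n.+1 ^ K)%:R * d ^+ n)).
    apply: (@le_trans _ _ (#|[set (V :\: Z) :|: (S :&: V) | S in [set S in Sm | #|S| <= K]%N]|%:R
       + #|\bigcup_(S in [set S in Sm | (S \subset Z) && (#|S| == K)]) L S|%:R)).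
      by rewrite -natrD ler_nat leq_card_setU.
    apply: lerD; first by rewrite ler_nat; apply: leq_trans (leq_imset_card _ _) (cSm' _).
    apply: le_trans (card_bigcup_le (k := d ^+ n) _) _.
      move=> S _; have [h _ _] := HL S; apply: le_trans h _.
      by apply: ler_weXn2l; [exact: ltW|exact: max_card].
    by apply: ler_wpM2r; rewrite ?exprn_ge0 ?ler_nat ?cSm' //; lra.
  have dn1 : 1 <= d ^+ n by apply: exprn_ege1; exact: ltW.
  have h0 : 0 <= (n.+1 ^ K)%:R :> R by [].
  apply: (@le_trans _ _ ((2 * n.+1 ^ K)%:R * d ^+ n)).
    rewrite natrM -[leRHS]mulrA [leRHS]mulr_natl mulr2n; apply: lerD => //.
    by apply: ler_peMr.
  apply: (@le_trans _ _ (d ^+ n * d ^+ n)).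
    by apply: ler_wpM2r => //; lra.
  by rewrite -exprMn; apply: lerXn2r; rewrite ?nnegrE -?expr2 ?sqr_ge0 //; lra.
- move=> F; rewrite inE => /orP[/imsetP[S]|/bigcupP[S]]; rewrite inE.
    move=> /andP[_ cS] ->; left.
    have := schur_pairs_le (subsetIr S V) ZV; rewrite -(ler_nat R) natrD natrM => h.
    apply: le_trans h _.
    have h1 : (#|S :&: V| + 3)%:R * n%:R <= delta * n%:R ^+ 2.
      rewrite expr2 mulrA; apply: ler_wpM2r => //; apply: le_trans HN2.
      rewrite ler_nat leq_add2r; apply: leq_trans cS; exact/subset_leq_card/subsetIl.
    have h2 : (\sum_(z in V :\: Z) link_degree V z)%:R <= delta * n%:R ^+ 2.
      apply: (@le_trans _ _ (\sum_(z in V :\: Z) delta * n%:R)).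
        rewrite natr_sum; apply: ler_sum => z; rewrite !inE negb_and => /andP[/orP[/negPf ->//|h'] zV].
        by rewrite ltW // ltNge.
      rewrite sumr_const -[leLHS]mulr_natr expr2 mulrA; apply: ler_wpM2l.
        by rewrite mulr_ge0 // ltW.
      by rewrite ler_nat max_card.
    by rewrite -/n; lra.
  move=> /andP[_ /andP[SZ /eqP cS]] FL; right.
  have [_ /(_ F FL)[FV dF] _] := HL S.
  apply: (@link_container_shrinks R G V F S delta theta%:R) => //.
  - exact: subset_trans SZ ZV.
  - by rewrite cS.
  - by move=> z /(subsetP SZ); rewrite inE => /andP[].
  - by move=> x /dF h; rewrite ler_nat ltnW.
  - by rewrite cS.
move=> M MV sfM; have [cM|cM] := leqP #|M :&: Z| K.
  exists ((V :\: Z) :|: ((M :&: Z) :&: V)).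
    rewrite inE; apply/orP; left; apply/imsetP; exists (M :&: Z) => //.
    by rewrite inE cM hSm.
  apply/subsetP => x xM; rewrite !inE xM (subsetP MV x xM) /=.
  by case: (delta * _ <= _).
have [S SMZ cS] := exists_subset_card (ltnW cM).
have [_ _ /(_ M MV)[|A AL MA]] := HL S.
  apply/indepP => x y; apply: link_sumfree sfM _.
  by apply: subset_trans SMZ _; apply: subsetIl.
exists A => //; rewrite inE; apply/orP; right; apply/bigcupP; exists S => //.
rewrite inE hSm ?cS // eqxx andbT; apply: subset_trans SMZ _; exact: subsetIr.
Qed.

(** Apply [container_step] again to every container that still has too many Schur pairs. Each round
    removes a proportion [g] of the group, so more than [1 / g] rounds leave only the first
    alternative. The rate is split once per round. *)
Lemma containers (R : archiRealFieldType) (delta c : R) : 0 < delta -> 1 < c ->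
  exists N : nat, forall G : finZmodType, (N <= #|G|)%N ->
  exists L : {set {set G}}, [/\ #|L|%:R <= c ^+ #|G|,
    forall F, F \in L -> (schur_pairs F)%:R <= delta * #|G|%:R ^+ 2
  & forall M : {set G}, distinct_sum_free M -> exists2 F, F \in L & M \subset F].
Proof.
move=> delta0 c1; pose g := delta / 2 / 36.
have g0 : 0 < g by rewrite !divr_gt0.
have H (t : nat) : forall c : R, 1 < c -> exists N : nat, forall G : finZmodType, (N <= #|G|)%N ->
  exists L : {set {set G}}, [/\ #|L|%:R <= c ^+ #|G|,
    forall F, F \in L -> (schur_pairs F)%:R <= delta * #|G|%:R ^+ 2
      \/ #|F|%:R <= #|G|%:R - t%:R * g * #|G|%:R
  & forall M : {set G}, distinct_sum_free M -> exists2 F, F \in L & M \subset F].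
  elim: t => [|t IH] {c1}c c1.
    exists 0%N => G _; exists [set setT]; split.
    - by rewrite cards1 exprn_ege1 // ltW.
    - by move=> F /set1P ->; right; rewrite !mul0r subr0 cardsT.
    - by move=> M _; exists setT; rewrite ?set11 ?subsetT.
  have [d d1 dc] := sqrt_gt1 c1; have [N1 HN1] := IH d d1.
  have delta2 : 0 < delta / 2 by rewrite divr_gt0.
  have [N2 HN2] := container_step delta2 d1.
  exists (maxn N1 N2) => G; rewrite geq_max => /andP[/HN1 [L [cL hL iL]] /HN2 st].
  have [f hf] := fin_all_exists (U := fun=> {set {set G}}) st.
  exists (\bigcup_(V in L) if (schur_pairs V)%:R <= delta * #|G|%:R ^+ 2 then [set V] else f V).
  have dG : 1 <= d ^+ #|G| by rewrite exprn_ege1 // ltW.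
  split.
  - apply: le_trans (card_bigcup_le (k := d ^+ #|G|) _) _.
      move=> V _; case: ifP => _; first by rewrite cards1.
      by have [] := hf V.
    apply: (@le_trans _ _ (d ^+ #|G| * d ^+ #|G|)); first by apply: ler_wpM2r => //; lra.
    by rewrite -exprMn; apply: lerXn2r; rewrite ?nnegrE -?expr2 ?sqr_ge0 //; lra.
  - move=> F /bigcupP[V VL]; case: ifP => [hV /set1P ->|hV FV]; first by left.
    have [_ /(_ F FV) h _] := hf V; case: h => h; [left|right].
      by apply: le_trans h _; rewrite (_ : 2 * (delta / 2) = delta) //; field.
    case: (hL V VL) => [h'|h']; first by rewrite h' in hV.
    by apply: le_trans h _; rewrite -/g -natr1; lra.
  - move=> M sfM; have [V VL MV] := iL M sfM.
    have [hV|hV] := boolP ((schur_pairs V)%:R <= delta * #|G|%:R ^+ 2).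
      by exists V => //; apply/bigcupP; exists V; rewrite // hV set11.
    have [_ _ /(_ M MV sfM)[F FV MF]] := hf V.
    by exists F => //; apply/bigcupP; exists V; rewrite // (negPf hV).
have [t ht] : exists t : nat, 1 / g < t%:R.
  by eexists; apply: archi_boundP; rewrite divr_ge0 // ltW.
have [N HN] := H t c c1; exists N => G /HN[L [cL hL iL]]; exists L; split=> //.
move=> F /hL [//|]; have G0 : 0 < #|G|%:R :> R.
  by rewrite ltr0n; apply/card_gt0P; exists 0.
rewrite ltr_pdivrMr // in ht.
have : #|G|%:R < t%:R * g * #|G|%:R by rewrite -[ltLHS]mul1r ltr_pM2r.
have : 0 <= #|F|%:R :> R by []. 
by lra.
Qed.

(** * Cosets of subgroups of index 2 *)

Inductive zexpr := ZVar of nat | ZZero | ZAdd of zexpr & zexpr | ZOpp of zexpr.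

Fixpoint zeval (V : zmodType) (env : seq V) e : V :=
  match e with
  | ZVar i => env`_i
  | ZZero => 0
  | ZAdd a b => zeval env a + zeval env b
  | ZOpp a => - zeval env a
  end.

Fixpoint zcoef e (i : nat) : int :=
  match e with
  | ZVar j => (i == j)%:Z
  | ZZero => 0
  | ZAdd a b => zcoef a i + zcoef b i
  | ZOpp a => - zcoef a i
  end.

Lemma zevalE (V : zmodType) (env : seq V) e :
  zeval env e = \sum_(i < size env) env`_i *~ zcoef e i.
Proof.
elim: e => [j||a IHa b IHb|a IHa] /=.
- have [hj|hj] := ltnP j (size env); last first.
    rewrite nth_default // big1 // => i _.
    by rewrite (_ : (i == j :> nat) = false) ?mulr0z //; apply/eqP => h; move: hj; rewrite -h leqNgt ltn_ord.
  rewrite (bigD1 (Ordinal hj)) //= eqxx mulr1z big1 ?addr0 // => i hi.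
  by rewrite (_ : (i == j :> nat) = false) ?mulr0z //; apply/negbTE.
- by rewrite big1 // => i _; rewrite mulr0z.
- by rewrite IHa IHb -big_split /=; apply: eq_bigr => i _; rewrite mulrzDr.
- by rewrite IHa -sumrN; apply: eq_bigr => i _; rewrite mulrNz.
Qed.

Lemma zeval_eq (V : zmodType) (env : seq V) a b :
  all (fun i => zcoef a i == zcoef b i) (iota 0 (size env)) -> zeval env a = zeval env b.
Proof.
move=> /allP h; rewrite !zevalE; apply: eq_bigr => i _; congr (_ *~ _); apply/eqP/h.
by rewrite mem_iota ltn_ord.
Qed.

Ltac zvars t l :=
  lazymatch t with
  | (?a + ?b)%R => let l := zvars a l in zvars b l
  | (- ?a)%R => zvars a l
  | 0%R => l
  | _ =>
    let rec mem l0 := lazymatch l0 with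
      | nil => constr:(cons t l)
      | cons t _ => l
      | cons _ ?l1 => mem l1
      end in mem l
  end.

Ltac zindex t l :=
  lazymatch l with
  | cons t _ => constr:(O)
  | cons _ ?l1 => let i := zindex t l1 in constr:(S i)
  end.

Ltac zreify t l :=
  lazymatch t with
  | (?a + ?b)%R => let a := zreify a l in let b := zreify b l in constr:(ZAdd a b)
  | (- ?a)%R => let a := zreify a l in constr:(ZOpp a)
  | 0%R => constr:(ZZero)
  | _ => let i := zindex t l in constr:(ZVar i)
  end.

(* Decides identities of abelian groups. *)
Ltac zmod :=
  match goal with
  | |- @eq ?V ?a ?b =>
    let l := zvars a (@nil V) in let l := zvars b l in
    let ra := zreify a l in let rb := zreify b l in
    exact: (@zeval_eq _ l ra rb isT)
  end.

(** Reduces an equation that is a rearrangement of a known one to a universal identity, which [zmod]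
    decides. *)
Lemma eq_of_sub (V : zmodType) (a b x y : V) : a = b -> x - y = a - b -> x = y.
Proof. by move=> ->; rewrite subrr => /eqP; rewrite subr_eq0 => /eqP. Qed.

Ltac zmod_from h :=
  first [apply: (eq_of_sub h); zmod | apply: (eq_of_sub (esym h)); zmod].

(* Freiman: two translates of [A] inside [A - A] have more than half of [A] in
   common, so [A - A] is a subgroup; it is disjoint from [A], hence of index 2. *)
Lemma sum_free_in_coset (G : finZmodType) (A : {set G}) :
  (forall x y, x \in A -> y \in A -> x + y \notin A) -> (2 * #|G| < 5 * #|A|)%N ->
  exists chi : G -> bool, (forall x y, chi (x + y) = chi x (+) chi y) /\
    forall x, x \in A -> chi x.
Proof.
move=> sfA cA; pose H : {set G} := [set p.1 - p.2 | p in setX A A].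
have HP x : reflect (exists a b, [/\ a \in A, b \in A & x = a - b]) (x \in H).
  apply: (iffP imsetP) => [[[a b] /setXP[aA bA] ->]|[a [b [aA bA ->]]]].
    by exists a, b.
  by exists (a, b); rewrite ?inE ?aA.
have dAH x : x \in A -> x \notin H.
  move=> xA; apply/negP => /HP[a [b [aA bA xE]]]; have := sfA x b xA bA.
  by rewrite xE subrK aA.
have cAH : (#|A| + #|H| <= #|G|)%N.
  rewrite -cardsUI (_ : A :&: H = set0) ?cards0 ?addn0 ?max_card //.
  by apply/setP => x; rewrite !inE; case: (boolP (x \in A)) => // /dAH /negPf.
(* For [x = a - b] the translates [A - a] and [A - b] both lie in [H], which has fewer than 3/2 #|A|
   elements as it is disjoint from [A]. *)
have half x : x \in H -> (#|A| < 2 * #|A :&: [set a | (a - x)%R \in A]|)%N.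
  move=> /HP[a [b [aA bA ->]]]; pose P := [set y - a | y in A]; pose Q := [set y - b | y in A].
  have cP : #|P| = #|A| by rewrite card_imset //; apply: addIr.
  have cQ : #|Q| = #|A| by rewrite card_imset //; apply: addIr.
  have cPQ : (#|P :|: Q| <= #|H|)%N.
    apply/subset_leq_card/subsetP => z; rewrite inE => /orP[]/imsetP[y yA ->]; apply/HP.
      by exists y, a.
    by exists y, b.
  have -> : #|A :&: [set a0 | a0 - (a - b) \in A]| = #|P :&: Q|.
    rewrite -[RHS](card_imset _ (addIr a)); apply: eq_card => z; rewrite !inE.
    apply/andP/imsetP => [[zA hz]|[y /setIP[/imsetP[y1 y1A ->] /imsetP[y2 y2A e2]] ->]].
      exists (z - a); last by rewrite subrK.
      rewrite inE; apply/andP; split; apply/imsetP; first by exists z.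
      exists (z - (a - b)) => //; zmod.
    rewrite subrK y1A; split=> //.
    by rewrite (_ : y1 - (a - b) = y2) //; zmod_from e2.
  have := cardsUI P Q; rewrite cP cQ => h.
  by clear -h cPQ cAH cA; lia.
have subH x y : x \in H -> y \in H -> x - y \in H.
  move=> xH yH; have hx := half x xH; have hy := half y yH.
  set P := A :&: _ in hx; set Q := A :&: _ in hy.
  have [z /setIP[/setIP[_ zP] /setIP[_ zQ]]] : exists z, z \in P :&: Q.
    apply/set0Pn; rewrite -card_gt0; have := cardsUI P Q.
    have : (#|P :|: Q| <= #|A|)%N.
      by apply: subset_leq_card; rewrite subUset !subsetIl.
    by clear -hx hy; lia.
  rewrite !inE in zP zQ; apply/HP; exists (z - y), (z - x); split=> //; zmod.
have A0 : (0 < #|A|)%N by clear -cA; lia.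
have H0 : 0 \in H.
  by case/card_gt0P: A0 => a aA; apply/HP; exists a, a; rewrite subrr.
have oppH x : x \in H -> - x \in H by move=> xH; rewrite -[- x]add0r subH.
have addH x y : x \in H -> y \in H -> x + y \in H.
  by move=> xH yH; rewrite -[y]opprK subH // oppH.
have cHA : (#|A| <= #|H|)%N.
  case/card_gt0P: A0 => a aA; rewrite -(card_imset _ (addIr (- a))).
  by apply/subset_leq_card/subsetP => _ /imsetP[y yA ->]; apply/HP; exists y, a.
(* Otherwise [H], [H + x] and [H - y] would be disjoint, with at least 3 #|A| > #|G| elements
   together. *)
have notH x y : x \notin H -> y \notin H -> x + y \in H.
  move=> xH yH; apply: contraT => xyH.
  pose P := [set z + x | z in H]; pose Q := [set z - y | z in H].
  have cP : #|P| = #|H| by rewrite card_imset //; apply: addIr.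
  have cQ : #|Q| = #|H| by rewrite card_imset //; apply: addIr.
  have d1 : H :&: P = set0.
    apply/setP => z; rewrite !inE; apply/negP => /andP[zH /imsetP[u uH zE]].
    by case/negP: xH; rewrite (_ : x = z - u) ?subH //; zmod_from zE.
  have d2 : (H :|: P) :&: Q = set0.
    apply/setP => z; rewrite !inE; apply/negP => /andP[/orP[zH|/imsetP[v vH zE']] /imsetP[u uH zE]].
      case/negP: yH; rewrite (_ : y = u - z) ?subH //; zmod_from zE.
    case/negP: xyH; rewrite (_ : x + y = u - v) ?subH //.
    have e : v + x = u - y by rewrite -zE' -zE.
    zmod_from e.
  have h1 := cardsUI H P; have h2 := cardsUI (H :|: P) Q.
  rewrite d1 cP in h1; rewrite d2 cQ in h2; rewrite !cards0 in h1 h2.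
  have h3 : (#|H :|: P :|: Q| <= #|G|)%N by exact: max_card.
  by clear -h1 h2 h3 cHA cA; lia.
exists (fun x => x \notin H); split; last exact: dAH.
move=> x y; have [xH|xH] := boolP (x \in H); have [yH|yH] := boolP (y \in H) => /=.
- by rewrite addH.
- by apply: contra yH => h; rewrite (_ : y = x + y - x) ?subH //; zmod.
- by apply: contra xH => h; rewrite (_ : x = x + y - y) ?subH //; zmod.
- by rewrite notH.
Qed.

(** * The nontrivial coset, given by a parity [chi], and its nearly 4-regular link graphs *)

Section OddCoset.
Context {R : rcfType} {G : finZmodType} (chi : G -> bool).
Hypothesis chiD : forall x y, chi (x + y) = chi x (+) chi y.
Implicit Types (x y z s t p q : G) (E U : {set G}).

Lemma chi0 : chi 0 = false.
Proof. by have := chiD 0 0; rewrite addr0; case: (chi 0). Qed.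

Lemma chiN x : chi (- x) = chi x.
Proof. by have := chiD x (- x); rewrite subrr chi0; case: (chi x); case: (chi (- x)). Qed.

Definition coset := [set x | chi x].

Lemma card_coset : (exists x, chi x) -> (2 * #|coset|)%N = #|G|.
Proof.
case=> b chib; rewrite mul2n -addnn -[RHS](cardsC coset); congr (_ + _)%N.
rewrite -(card_imset _ (addIr b)); apply: eq_card => x; rewrite !inE.
apply/imsetP/idP => [[y]|hx]; first by rewrite inE => chiy ->; rewrite chiD chiy chib.
by exists (x - b); rewrite ?subrK // inE chiD chiN chib (negPf hx).
Qed.

(** Elements of different parity differ, so [x != y] is all that remains of distinctness. *)
Lemma link_coset E x y : (forall s, s \in E -> ~~ chi s) -> x \in coset -> y \in coset ->
  link E x y = (x != y) && [exists s in E, [|| x + y == s, x + s == y | y + s == x]].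
Proof.
move=> evE; rewrite !inE => chix chiy; rewrite linkE; congr (_ && _).
apply: eq_existsb_in => s sE; have chis := evE s sE.
have -> : s != x by apply: contraNneq chis => ->.
by have -> : s != y by apply: contraNneq chis => ->.
Qed.

(** Neighbours of [x] coincide with each other or with [x] only when [2 x] takes one of finitely
    many values; such sets collect the exceptional vertices. *)
Definition doubles_in (l : seq G) := [set x | x + x \in l].

Lemma card_doubles_in (l : seq G) k : (forall c, #|[set x : G | (x + x)%R == c]| <= k)%N ->
  (#|doubles_in l| <= size l * k)%N.
Proof.
move=> hk; elim: l => [|c l IH] /=.
  by rewrite (_ : doubles_in _ = set0) ?cards0 //; apply/setP => x; rewrite !inE.
rewrite mulSn (_ : doubles_in _ = [set x | x + x == c] :|: doubles_in l).
  by apply: leq_trans (leq_card_setU _ _) _; apply: leq_add.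
by apply/setP => x; rewrite !inE.
Qed.

Section FourShifts.
Variables (E : {set G}) (p q s t : G) (k : nat).
Hypothesis evE : forall s, s \in E -> ~~ chi s.
Hypotheses (sE : s \in E) (tE : t \in E) (st : s != t) (pq : p != q).
Hypotheses (p0 : p != 0) (q0 : q != 0).
Hypotheses (pE : (p \in E) || (- p \in E)) (qE : (q \in E) || (- q \in E)).
Hypothesis pqN : (- p \in [set p; q]) && (- q \in [set p; q]).
Hypothesis hk : forall c, (#|[set x : G | (x + x)%R == c]| <= k)%N.
Hypothesis k_small : (192 * k <= #|coset|)%N.

(** Two translates and two reflections. The condition [pqN] covers both uses, [q = - p] and two
    elements [p], [q] of order 2, and makes the relation symmetric. *)
Let shifts x := [:: x + p; x + q; s - x; t - x].
Let e' : rel G := fun x y => [&& x \in coset, x != y & y \in shifts x].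

Let chip : chi p = false.
Proof. by apply/negbTE; case/orP: pE => /evE //; rewrite chiN. Qed.
Let chiq : chi q = false.
Proof. by apply/negbTE; case/orP: qE => /evE //; rewrite chiN. Qed.
Let chis : chi s = false. Proof. exact/negbTE/evE. Qed.
Let chit : chi t = false. Proof. exact/negbTE/evE. Qed.

Let shifts_coset x y : x \in coset -> y \in shifts x -> y \in coset.
Proof.
rewrite !inE => chix /or4P[]/eqP ->;
  by rewrite chiD ?chiN chix ?chip ?chiq ?chis ?chit.
Qed.

Let shifts_sym x y : y \in shifts x -> x \in shifts y.
Proof.
move: pqN; rewrite !inE => /andP[hp hq] /or4P[]/eqP ->.
- case/orP: hp => /eqP h.
    by have <- : x = x + p + p; [zmod_from h|rewrite eqxx].
  by have <- : x = x + p + q; [zmod_from h|rewrite eqxx orbT].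
- case/orP: hq => /eqP h.
    by have <- : x = x + q + p; [zmod_from h|rewrite eqxx].
  by have <- : x = x + q + q; [zmod_from h|rewrite eqxx orbT].
- by rewrite (_ : s - (s - x) = x) ?eqxx ?orbT //; zmod.
- by rewrite (_ : t - (t - x) = x) ?eqxx ?orbT //; zmod.
Qed.

Let e'_sym : symmetric e'.
Proof.
have h x y : e' x y -> e' y x.
  by case/and3P => xB xy yx; rewrite /e' eq_sym xy (shifts_coset xB) // shifts_sym.
by move=> x y; apply/idP/idP; apply: h.
Qed.

Let e'_sub x y : e' x y -> link E x y.
Proof.
case/and3P => xB xy yx; rewrite (link_coset evE xB (shifts_coset xB yx)) xy /=.
move: yx; rewrite !inE => /or4P[]/eqP ->; apply/exists_inP.
- case/orP: pE => h; [exists p|exists (- p)] => //; first by rewrite eqxx ?orbT.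
  by rewrite addrK eqxx !orbT.
- case/orP: qE => h; [exists q|exists (- q)] => //; first by rewrite eqxx ?orbT.
  by rewrite addrK eqxx !orbT.
- by exists s => //; rewrite addrC subrK eqxx.
- by exists t => //; rewrite addrC subrK eqxx.
Qed.

(** The first four values make a translate equal to a reflection, the last two make [x] its own
    reflection. Six values with at most [k] halves each, times 32, give the 192 of [k_small]. *)
Let bad := [:: s - p; s - q; t - p; t - q; s; t].

Let deg_in4 x : x \in coset -> x \notin doubles_in bad -> deg_in e' coset x = 4%N.
Proof.
move=> xB; rewrite !inE !negb_or => /and5P[h1 h2 h3 h4 /andP[h5 h6]].
have -> : deg_in e' coset x = #|shifts x|.
  apply: eq_card => y; rewrite [LHS]inE [y \in nbh _ _]inE.
  apply/andP/idP => [[/and3P[]]//|yx]; have yB := shifts_coset xB yx; rewrite yB; split=> //.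
  rewrite /e' xB yx andbT /=; apply/eqP => xy; move: yx; rewrite -xy !inE.
  case/or4P => /eqP e.
  - by case/eqP: p0; zmod_from e.
  - by case/eqP: q0; zmod_from e.
  - by case/eqP: h5; zmod_from e.
  - by case/eqP: h6; zmod_from e.
apply/(@card_uniqP _ (shifts x)); rewrite /= !inE !negb_or !andbT -!andbA.
do ?[apply/andP; split].
- by apply: contra pq => /eqP/addrI ->.
- by apply: contra h1 => /eqP e; apply/eqP; zmod_from e.
- by apply: contra h3 => /eqP e; apply/eqP; zmod_from e.
- by apply: contra h2 => /eqP e; apply/eqP; zmod_from e.
- by apply: contra h4 => /eqP e; apply/eqP; zmod_from e.
- by apply: contra st => /eqP/addIr ->.
Qed.

Let deg4 x : (#|nbh e' x| <= 4)%N.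
Proof.
apply: leq_trans (card_size (shifts x)); apply/subset_leq_card/subsetP => y.
by rewrite inE => /and3P[].
Qed.

(* [13/9] is just above the cubic root of 3, and [91/90] is small enough for
   branching and large enough to bring the weight [g / b ^ 2] of a vertex of
   degree 4 below [sqrt 2]. *)
Lemma nmis_four_shifts : (nmis (link E) coset)%:R ^+ 2 <= 2 ^+ #|coset| :> R.
Proof.
have [g gE] : exists g : R, g = 13 / 9 by eexists.
have [b bE] : exists b : R, b = 91 / 90 by eexists.
have g1 : 1 <= g by rewrite gE; lra.
have b1 : 1 <= b by rewrite bE; lra.
have hg (j : nat) : j%:R <= g ^+ j by rewrite gE natr_le_expr.
pose m := #|coset|; pose B0 := coset :&: doubles_in bad.
have hB0 : (32 * #|B0| <= m)%N.
  have h : (#|B0| <= 6 * k)%N.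
    apply: leq_trans (card_doubles_in bad hk); exact/subset_leq_card/subsetIr.
  by apply: leq_trans k_small; rewrite (_ : 192 * k = 32 * (6 * k))%N ?leq_mul2l // mulnA.
have hexc : (2 * (m - #|B0|) <= excess e' coset)%N.
  have -> : (m - #|B0| = #|coset :\: doubles_in bad|)%N.
    by rewrite /m -(cardsID (doubles_in bad) coset) addKn.
  rewrite /excess (big_setID (doubles_in bad)) /= mulnC -sum_nat_const.
  apply: leq_trans (leq_addl _ _); apply: leq_sum => x; rewrite inE => /andP[xb xB].
  by rewrite deg_in4.
have main : (nmis (link E) coset)%:R * b ^+ excess e' coset <= g ^+ m.
  have <- : weight (fun=> g) coset = g ^+ m by rewrite /weight prodr_const.
  apply: (@nmis_potential R G (link E) e' (@link_sym G E) (@link_irr G E) e'_sym e'_sub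
    deg4 (fun=> g) g b g1 (fun=> lexx g) b1 _ _ (fun=> True)) => //.
  - by rewrite gE bE; lra.
  - by rewrite gE bE; lra.
  - move=> U _ _; exact: (nmis_le_weight (@link_sym G E) g1 (fun=> lexx g) hg).
have b0 : 0 < b by lra.
have main2 : (nmis (link E) coset)%:R ^+ 2 * (b ^+ 4) ^+ (m - #|B0|) <= (g ^+ 2) ^+ m.
  rewrite -!exprM [X in _ <= X](_ : _ = (g ^+ m) ^+ 2); last by rewrite -exprM mulnC.
  apply: (@le_trans _ _ (((nmis (link E) coset)%:R * b ^+ excess e' coset) ^+ 2)).
    rewrite exprMn -exprM; apply: ler_wpM2l; first by rewrite exprn_ge0.
    apply: ler_weXn2l => //; rewrite mulnC [X in (_ <= X)%N]mulnC.
    by rewrite (_ : (m - #|B0|) * 4 = 2 * (2 * (m - #|B0|)))%N ?leq_mul2l // mulnA mulnC.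
  by apply: lerXn2r; rewrite ?nnegrE ?mulr_ge0 ?exprn_ge0 //; lra.
(* After squaring, [rho < 1] is the saving per vertex if all degrees are 4. An exceptional vertex
   forfeits [b ^+ 4], and 32 factors [rho] repay it. *)
have [rho rhoE] : exists rho, rho = g ^+ 2 / (2 * b ^+ 4) by eexists.
have rho01 : 0 <= rho <= 1 by rewrite rhoE gE bE; lra.
have small : rho ^+ m * (b ^+ 4) ^+ #|B0| <= 1.
  apply: (@le_trans _ _ ((rho ^+ 32 * b ^+ 4) ^+ #|B0|)).
    rewrite (exprMn #|B0| (rho ^+ 32) (b ^+ 4)) -(exprM rho); apply: ler_wpM2r; first by rewrite exprn_ge0 ?exprn_ge0 // ltW.
    by apply: ler_wiXn2l; case/andP: rho01.
  apply: exprn_ile1; first by rewrite mulr_ge0 ?exprn_ge0 //; [case/andP: rho01|exact: ltW].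
  by rewrite rhoE gE bE; lra.
have bm0 : 0 < (b ^+ 4) ^+ (m - #|B0|) by rewrite !exprn_gt0.
rewrite -(ler_pM2r bm0); apply: le_trans main2 _.
have B0m : (#|B0| <= m)%N by exact/subset_leq_card/subsetIl.
have -> : (g ^+ 2) ^+ m = rho ^+ m * (b ^+ 4) ^+ #|B0| * (2 ^+ m * (b ^+ 4) ^+ (m - #|B0|)).
  have -> : g ^+ 2 = rho * (2 * b ^+ 4) by rewrite rhoE divfK // lt0r_neq0 // mulr_gt0 ?exprn_gt0.
  rewrite (exprMn m rho) (exprMn m 2) -[in (b ^+ 4) ^+ m](subnK B0m) (exprD (b ^+ 4)); ring.
by apply: ler_piMl => //; rewrite mulr_ge0 ?exprn_ge0 // ltW.
Qed.

End FourShifts.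
End OddCoset.

(** * The link graph of a single element *)

Section OneShift.
Context {R : rcfType} {G : finZmodType} (chi : G -> bool).
Hypothesis chiD : forall x y, chi (x + y) = chi x (+) chi y.
Variable s : G.
Hypothesis chis : ~~ chi s.
Implicit Types (x y z v w : G) (U : {set G}).

Local Notation B := (coset chi).
Local Notation lk := (link [set s]).

Lemma link1E x y : x \in B -> y \in B ->
  lk x y = (x != y) && [|| x + y == s, x + s == y | y + s == x].
Proof.
move=> xB yB; rewrite (@link_coset _ chi) //; last by move=> z /set1P ->.
congr (_ && _); apply/exists_inP/idP => [[z /set1P -> //]|h].
by exists s; rewrite ?set11.
Qed.

(** The only possible neighbours of [x] are [x + s] and [s - x], and these two are not adjacent. So
    the degrees are at most 2, there is no triangle, and the weight [sqrt 2] is allowed. *)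
Lemma nmis_one_involution : s + s = 0 -> (nmis lk B)%:R ^+ 2 <= 2 ^+ #|B| :> R.
Proof.
move=> ss; have w2 : Num.sqrt (2 : R) ^+ 2 = 2 by rewrite sqr_sqrtr.
have w0 : 0 <= Num.sqrt (2 : R) by exact: sqrtr_ge0.
have w1 : 1 <= Num.sqrt (2 : R).
  by rewrite -(ler_sqr (x := 1)) ?nnegrE // w2 expr1n; lra.
have adj x y : x \in B -> y \in B -> lk x y -> y = x + s \/ y = s - x.
  move=> xB yB; rewrite link1E // => /andP[_ /or3P[]/eqP h]; [right|left|left].
  - zmod_from h.
  - by rewrite h.
  - have e : y + s + (s + s) = x + (s + s) by rewrite h.
    rewrite ss !addr0 in e; rewrite -h -addrA ss addr0 //.
have := @nmis_le_weight_deg2 R G lk (@link_sym G _) (@link_irr G _) (fun=> Num.sqrt 2) _ w1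
  (fun=> lexx _) _ B _ _.
rewrite w2 => /(_ (lexx 2)) h.
have {h}main : (nmis lk B)%:R <= Num.sqrt (2 : R) ^+ #|B|.
  rewrite (_ : Num.sqrt (2 : R) ^+ #|B| = weight (fun=> Num.sqrt 2) B); last first.
    by rewrite /weight prodr_const.
  apply: h => [v vB|x y z xB yB zB xy yz xz].
    apply: (@leq_trans #|[set v + s; s - v]|); last by rewrite cards2; case: (_ != _).
    apply/subset_leq_card/subsetP => y /setIP[]; rewrite inE => vy yB.
    by have [->|->] := adj v y vB yB vy; rewrite !inE eqxx ?orbT.
  exfalso.
  have key : lk x (x + s) -> lk x (s - x) -> x + s \in B -> s - x \in B -> ~~ lk (x + s) (s - x).
    move=> l1 l2 B1 B2; rewrite link1E // negb_and negbK -implyNb; apply/implyP => _.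
    rewrite link1E // in l1; rewrite link1E // in l2.
    have /andP[n1 _] := l1; have /andP[n2 _] := l2; apply/norP; split; [|apply/norP; split].
    - apply: contra n1 => /eqP h; have s0 : s = 0 by zmod_from h.
      by rewrite s0 addr0.
    - apply: contra n2 => /eqP; rewrite -addrA ss addr0 => <-; exact: eqxx.
    - apply: contra n2 => /eqP h; apply/eqP/esym; zmod_from h.
  have [yE|yE] := adj x y xB yB xy; have [zE|zE] := adj x z xB zB xz.
  - by move: yz; rewrite yE zE link_irr.
  - by rewrite yE in xy yB yz; rewrite zE in xz zB yz; have := key xy xz yB zB; rewrite yz.
  - rewrite yE in xy yB yz; rewrite zE in xz zB yz; have := key xz xy zB yB.
    by rewrite link_sym yz.
  - by move: yz; rewrite yE zE link_irr.
rewrite -w2 -exprM mulnC exprM; apply: lerXn2r; rewrite ?nnegrE ?exprn_ge0 //.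
Qed.

Section Involutionless.
Variable k : nat.
Hypothesis ss : s + s != 0.
Hypothesis hk : forall c, (#|[set x : G | (x + x)%R == c]| <= k)%N.
Hypothesis k_small : (192 * k <= #|B|)%N.

Let s0 : s != 0.
Proof. by apply: contra ss => /eqP ->; rewrite addr0. Qed.

(** For [2 x] equal to 0, [s] or [2 s] the reflection [s - x] meets [x + s], [x] or [x - s]. For
    [- s] and [3 s] it becomes adjacent to [x + s] or [x - s], which would create triangles. *)
Let bad := [:: 0; s; s + s; - s; s + s + s].

Let lk_nbh x y : x \in B -> y \in B -> lk x y -> y \in [:: x + s; x - s; s - x].
Proof.
move=> xB yB; rewrite link1E // !inE => /andP[_ /or3P[]/eqP <-].
- by rewrite [x + y]addrC addrK eqxx !orbT.
- by rewrite eqxx.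
- by rewrite addrK eqxx orbT.
Qed.

Let B_nbh x : x \in B -> [/\ x + s \in B, x - s \in B & s - x \in B].
Proof. by rewrite !inE !chiD !(chiN chiD) => ->; rewrite (negPf chis). Qed.

Let lk_add x : x \in B -> lk x (x + s).
Proof.
move=> xB; have [B1 _ _] := B_nbh xB; rewrite link1E // eqxx orbT andbT.
by apply: contra s0 => /eqP h; apply/eqP; zmod_from h.
Qed.

Let lk_sub x : x \in B -> lk x (x - s).
Proof. by move=> xB; have [_ B2 _] := B_nbh xB; rewrite link_sym -{2}(subrK s x) lk_add. Qed.

Let lk_opp x : x \in B -> x + x != s -> lk x (s - x).
Proof.
move=> xB hx; have [_ _ B3] := B_nbh xB; rewrite link1E // [x + _]addrC subrK eqxx andbT.
by apply: contra hx => /eqP h; apply/eqP; zmod_from h.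
Qed.

Let deg_ge3 U x : U \subset B -> x \in U -> (3 <= deg_in lk U x)%N ->
  [/\ x + s \in U, x - s \in U & s - x \in U].
Proof.
move=> /subsetP UB xU h; have xB := UB x xU.
have sub y : y \in nbh lk x :&: U -> y \in [:: x + s; x - s; s - x].
  by case/setIP; rewrite inE => xy /UB yB; apply: lk_nbh.
have pick (a b c : G) : (forall y, y \in nbh lk x :&: U -> y \in [:: a; b; c]) -> a \in U.
  move=> hs; apply: contraT => aU; suff : (deg_in lk U x <= 2)%N by rewrite leqNgt h.
  apply: leq_trans (card_size [:: b; c]); apply/subset_leq_card/subsetP => y yN.
  by move: (hs y yN); rewrite inE => /predU1P[ya|//]; move: yN aU; rewrite ya => /setIP[_ ->].
split; [apply: (pick _ (x - s) (s - x))|apply: (pick _ (x + s) (s - x))|apply: (pick _ (x - s) (x + s))];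
  by move=> y /sub; rewrite !inE; case: (_ == _); case: (_ == _); case: (_ == _).
Qed.

(* When [3 s = 0], the triangle [v + <s>] may only be isolated after all its
   neighbours were deleted; the recursion never does this, see [J_del]. *)
Let J U := U \subset B /\ (s + s + s = 0 -> forall v, v \in U -> v + s \in U -> v - s \in U ->
  v \notin doubles_in bad -> exists2 w, w \in U & w \in [:: s - v; - v; s + s - v]).

Let J_del U x : x \in U -> (3 <= deg_in lk U x)%N -> J U -> J (U :\ x).
Proof.
move=> xU dx [UB hU]; split; first by apply: subset_trans UB; exact: subsetDl.
move=> s3 v /setD1P[_ vU] /setD1P[_ v1U] /setD1P[_ v2U] vbad.
have [w wU wv] := hU s3 v vU v1U v2U vbad.
have [wx|wx] := eqVneq w x; last by exists w; rewrite // !inE wx.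
(* The deleted vertex had all its neighbours in [U]; as [3 s = 0], its neighbour [x + s] lies in the
   same reflected triangle and replaces it. *)
have [xsU _ _] := deg_ge3 UB xU dx; exists (x + s).
  rewrite !inE xsU andbT; apply: contra s0 => /eqP h; apply/eqP; zmod_from h.
move: wv; rewrite wx !inE => /or3P[]/eqP ->.
- by rewrite (_ : s - v + s = s + s - v) ?eqxx ?orbT //; zmod.
- by rewrite addrC eqxx.
- by rewrite (_ : s + s - v + s = - v) ?eqxx ?orbT //; zmod_from s3.
Qed.

Let J_nbh U x : x \in U -> (3 <= deg_in lk U x)%N -> J U -> J (U :\: cnbh lk x).
Proof.
move=> xU dx [UB hU]; split; first by apply: subset_trans UB; exact: subsetDl.
have xB := subsetP UB x xU.
move=> s3 v /setDP[vU vx] /setDP[v1U v1x] /setDP[v2U v2x] vbad.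
have [w wU wv] := hU s3 v vU v1U v2U vbad; exists w => //; rewrite inE wU andbT.
(* The triangle of [v] survives, so it contains neither [x] nor [s - x]. If [w] were deleted, [x]
   would lie in that triangle or in the reflected one, and then [x] or [s - x] would be in the
   triangle of [v]. *)
have notT u : u \in [:: v; v + s; v - s] -> u \notin cnbh lk x.
  by rewrite !in_cons in_nil orbF => /or3P[]/eqP ->.
have nx : x \notin [:: v; v + s; v - s].
  by apply/negP => /notT; rewrite setU11.
have nsx : s - x \notin [:: v; v + s; v - s].
  apply/negP => /notT; rewrite !inE negb_or => /andP[n1 n2].
  by case/negP: n2; apply: lk_opp xB _; apply: contra n1 => /eqP h; apply/eqP; zmod_from h.
apply/negP; rewrite !inE => /predU1P[wx|xw].
  case/negP: nsx; move: wv; rewrite wx !inE => /or3P[]/eqP ->.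
  - by rewrite (_ : s - (s - v) = v) ?eqxx //; zmod.
  - by rewrite (_ : s - - v = v + s) ?eqxx ?orbT //; zmod.
  - by rewrite (_ : s - (s + s - v) = v - s) ?eqxx ?orbT //; zmod.
have := lk_nbh xB (subsetP UB w wU) xw; rewrite !inE => /or3P[]/eqP wE.
- case/negP: nsx; move: wv; rewrite wE !inE => /or3P[]/eqP h.
  + by rewrite (_ : s - x = v + s) ?eqxx ?orbT //; zmod_from h.
  + have e : - v + (s + s + s) = x + s by rewrite s3 addr0.
    by rewrite (_ : s - x = v - s) ?eqxx ?orbT //; zmod_from e.
  + by rewrite (_ : s - x = v) ?eqxx //; zmod_from h.
- case/negP: nsx; move: wv; rewrite wE !inE => /or3P[]/eqP h.
  + by rewrite (_ : s - x = v - s) ?eqxx ?orbT //; zmod_from h.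
  + by rewrite (_ : s - x = v) ?eqxx //; zmod_from h.
  + have e : x - s + (s + s + s) = s + s - v by rewrite s3 addr0.
    by rewrite (_ : s - x = v + s) ?eqxx ?orbT //; zmod_from e.
- case/negP: nx; move: wv; rewrite wE !inE => /or3P[]/eqP h.
  + by rewrite (_ : x = v) ?eqxx //; zmod_from h.
  + by rewrite (_ : x = v + s) ?eqxx ?orbT //; zmod_from h.
  + by rewrite (_ : x = v - s) ?eqxx ?orbT //; zmod_from h.
Qed.

(** Since 3/2 * (17/12)^2 is at least 3, a triangle with an exceptional vertex meets the requirement
    of [nmis_le_weight_deg2]; triangles at ordinary vertices are ruled out. *)
Let wt x : R := if x \in doubles_in bad then 3 / 2 else 17 / 12.

Let deg3 x : x \in B -> x \notin doubles_in bad -> deg_in lk B x = 3%N.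
Proof.
move=> xB; rewrite !inE !negb_or => /and5P[h0 h1 h2 h3 h4].
have -> : deg_in lk B x = #|[:: x + s; x - s; s - x]|.
  apply: eq_card => y; apply/setIP/idP => [[]|].
    by rewrite inE => xy yB; exact: lk_nbh.
  have [B1 B2 B3] := B_nbh xB.
  rewrite !in_cons in_nil orbF => /or3P[]/eqP ->; rewrite inE; split=> //.
  - exact: lk_add.
  - exact: lk_sub.
  - exact: lk_opp.
apply/(@card_uniqP _ [:: _; _; _]); rewrite /= !inE !negb_or !andbT -andbA.
do ?[apply/andP; split].
- by apply: contra ss => /eqP h; apply/eqP; zmod_from h.
- by apply: contra h0 => /eqP h; apply/eqP; zmod_from h.
- by apply: contra h2 => /eqP h; apply/eqP; zmod_from h.
Qed.

Let J_leaf U : J U -> (forall v, v \in U -> (deg_in lk U v <= 2)%N) ->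
  (nmis lk U)%:R <= weight wt U.
Proof.
move=> [UB hU] hdeg; have w1 : (1 : R) <= 17 / 12 by lra.
have wge x : 17 / 12 <= wt x by rewrite /wt; case: ifP => _; lra.
apply: (nmis_le_weight_deg2 (@link_sym G _) (@link_irr G _) w1 wge) => //; first by lra.
move=> x y z xU yU zU xy yz xz; have [xb|xb] := boolP (x \in doubles_in bad).
  have h1 := wge y; have h2 := wge z; rewrite {1}/wt xb.
  have h3 : 17 / 12 * (17 / 12) <= wt y * wt z by apply: ler_pM => //; lra.
  by lra.
exfalso; have [xB yB zB] := And3 (subsetP UB x xU) (subsetP UB y yU) (subsetP UB z zU).
have := xb; rewrite !inE !negb_or => /and5P[h0 h1 h2 h3 h4].
have no_sum : ~~ lk (x + s) (s - x).
  have [B1 _ B3] := B_nbh xB; rewrite link1E // negb_and; apply/orP; right.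
  apply/norP; split; [|apply/norP; split].
  - by apply: contra s0 => /eqP h; apply/eqP; zmod_from h.
  - by apply: contra h3 => /eqP h; apply/eqP; zmod_from h.
  - by apply: contra h1 => /eqP h; apply/eqP; zmod_from h.
have no_dif : ~~ lk (x - s) (s - x).
  have [_ B2 B3] := B_nbh xB; rewrite link1E // negb_and; apply/orP; right.
  apply/norP; split; [|apply/norP; split].
  - by apply: contra s0 => /eqP h; apply/eqP; zmod_from h.
  - by apply: contra h1 => /eqP h; apply/eqP; zmod_from h.
  - by apply: contra h4 => /eqP h; apply/eqP; zmod_from h.
have no_tri : x + s \in U -> x - s \in U -> ~~ lk (x + s) (x - s).
  move=> x1U x2U; have [B1 B2 _] := B_nbh xB; apply/negP; rewrite link1E // => /andP[_ /or3P[]/eqP h].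
  - by case/eqP: h1; zmod_from h.
  - have s3 : s + s + s = 0 by zmod_from h.
    (* The vertex of the triangle that is joined to [w] has three neighbours in [U], against
       [hdeg]. *)
    have [w wU wx] := hU s3 x xU x1U x2U xb.
    have hT v : v \in U -> v + s \in U -> v - s \in U -> s - v \in U -> v + v != s -> v + v != 0 -> v + v != s + s -> False.
      move=> vU v1U v2U v3U e1 e2 e3; have := hdeg v vU; rewrite leqNgt => /negP; apply.
      have vB := subsetP UB v vU.
      have u3 : uniq [:: v + s; v - s; s - v].
        rewrite /= !inE !negb_or !andbT -andbA; do ?[apply/andP; split].
        - by apply: contra ss => /eqP e; apply/eqP; zmod_from e.
        - by apply: contra e2 => /eqP e; apply/eqP; zmod_from e.
        - by apply: contra e3 => /eqP e; apply/eqP; zmod_from e.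
      apply: (@leq_trans #|[:: v + s; v - s; s - v]|); first by rewrite (card_uniqP u3).
      apply/subset_leq_card/subsetP => y0.
      rewrite !in_cons in_nil orbF => /or3P[]/eqP ->; rewrite inE; apply/andP; split=> //; rewrite inE.
      - exact: lk_add.
      - exact: lk_sub.
      - exact: lk_opp.
    move: wx; rewrite !inE => /or3P[]/eqP wE.
    + by apply: (hT x) => //; rewrite -wE.
    + apply: (hT (x + s)) => //.
      * rewrite (_ : x + s + s = x - s) //; zmod_from s3.
      * by rewrite addrK.
      * by rewrite (_ : s - (x + s) = w) // wE; zmod.
      * apply: contra h3 => /eqP e; apply/eqP; zmod_from e.
      * apply: contra h1 => /eqP e; apply/eqP.
        have e' : x + s + (x + s) = s + s + s by rewrite e s3.
        zmod_from e'.
      * by apply: contra h0 => /eqP e; apply/eqP; zmod_from e.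
    + apply: (hT (x - s)) => //.
      * by rewrite subrK.
      * by rewrite (_ : x - s - s = x + s) //; zmod_from s3.
      * by rewrite (_ : s - (x - s) = w) // wE; zmod.
      * by apply: contra h4 => /eqP e; apply/eqP; zmod_from e.
      * by apply: contra h2 => /eqP e; apply/eqP; zmod_from e.
      * apply: contra h1 => /eqP e; apply/eqP.
        have e' : x - s + (x - s) = s + s - (s + s + s) by rewrite e s3 subr0.
        zmod_from e'.
  - have e : s + s + (x - s) = x - s + s + s by rewrite addrC addrA.
    by case/eqP: s0; zmod_from h.
have := lk_nbh xB yB xy; have := lk_nbh xB zB xz.
rewrite !in_cons !in_nil !orbF => /or3P[]/eqP zE /or3P[]/eqP yE; move: yz; rewrite yE zE.
- by rewrite link_irr.
- by rewrite zE in zU; rewrite yE in yU; rewrite link_sym (negPf (no_tri _ _)).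
- by rewrite link_sym (negPf no_sum).
- by rewrite zE in zU; rewrite yE in yU; rewrite (negPf (no_tri _ _)).
- by rewrite link_irr.
- by rewrite link_sym (negPf no_dif).
- by rewrite (negPf no_sum).
- by rewrite (negPf no_dif).
- by rewrite link_irr.
Qed.

(* [17/12] is just above [sqrt 2], and [h / b], the weight of a vertex of degree
   3, is just below it. *)
Lemma nmis_one_shift : (nmis lk B)%:R ^+ 2 <= 2 ^+ #|B| :> R.
Proof.
have [h hE] : exists h : R, h = 17 / 12 by eexists.
have [b bE] : exists b : R, b = 201 / 200 by eexists.
have [sg sgE] : exists sg, sg = h ^+ 2 / (2 * b ^+ 2) by eexists.
have b0 : 0 < b by rewrite bE; lra.
have b1 : 1 <= b by rewrite bE; lra.
have h1 : 1 <= h by rewrite hE; lra.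
pose B0 := B :&: doubles_in bad; pose m1 := #|B :\: doubles_in bad|.
have cB : (#|B| = #|B0| + m1)%N by rewrite -(cardsID (doubles_in bad) B).
have hB0 : (31 * #|B0| <= m1)%N.
  have hb : (#|B0| <= 5 * k)%N.
    apply: leq_trans (card_doubles_in bad hk); exact/subset_leq_card/subsetIr.
  by move: k_small; rewrite cB; clear -hb; lia.
have wE : weight wt B = (3 / 2) ^+ #|B0| * h ^+ m1.
  rewrite /weight (big_setID (doubles_in bad)) /= -!prodr_const hE.
  congr (_ * _); apply: eq_bigr => x; rewrite /wt; first by case/setIP => _ ->.
  by case/setDP => _ /negPf ->.
have hexc : (m1 <= excess lk B)%N.
  rewrite /excess (big_setID (doubles_in bad)) /= /m1 -sum1_card.
  apply: leq_trans (leq_addl _ _); apply: leq_sum => x /setDP[xB xb].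
  by rewrite deg3.
have main : (nmis lk B)%:R * b ^+ excess lk B <= weight wt B.
  apply: (@nmis_potential R G lk lk (@link_sym G _) (@link_irr G _) (@link_sym G _) _
    _ wt h b h1 _ b1 _ _ J) => //.
  - by move=> v; apply: leq_trans (card_nbh_link _ _) _; rewrite cards1.
  - by move=> x; rewrite /wt hE; case: ifP => _; lra.
  - by rewrite hE bE; lra.
  - by rewrite hE bE; lra.
  - split=> // s3 v vB _ _ _; exists (s - v); first by have [] := B_nbh vB.
    by rewrite inE eqxx.
have main2 : (nmis lk B)%:R ^+ 2 * (b ^+ 2) ^+ m1 <= (9 / 4) ^+ #|B0| * (h ^+ 2) ^+ m1.
  apply: (@le_trans _ _ (((nmis lk B)%:R * b ^+ excess lk B) ^+ 2)).
    rewrite (exprMn 2 _ (b ^+ excess lk B)) -!exprM; apply: ler_wpM2l; first by rewrite exprn_ge0.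
    by apply: ler_weXn2l => //; rewrite mulnC leq_mul2r hexc orbT.
  apply: (@le_trans _ _ (weight wt B ^+ 2)).
    apply: lerXn2r main; rewrite nnegrE; first by rewrite mulr_ge0 // exprn_ge0 // ltW.
    by rewrite wE mulr_ge0 ?exprn_ge0 //; lra.
  rewrite wE (exprMn 2 ((3 / 2) ^+ #|B0|)) -[X in X * _ <= _]exprM -[X in _ * X <= _]exprM.
  by rewrite mulnC [(m1 * 2)%N]mulnC !exprM (_ : (3 / 2) ^+ 2 = 9 / 4 :> R) //; lra.
have sg0 : 0 <= sg by rewrite sgE hE bE; lra.
have sg1 : sg <= 1 by rewrite sgE hE bE; lra.
(* After squaring, an exceptional vertex counts 9/4 instead of 2; the savings [sg] of 31 ordinary
   vertices make up for it. *)
have small : (9 / 4) ^+ #|B0| * sg ^+ m1 <= 2 ^+ #|B0|.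
  apply: (@le_trans _ _ ((9 / 4 * sg ^+ 31) ^+ #|B0|)).
    rewrite (exprMn #|B0| (9 / 4) (sg ^+ 31)) -(exprM sg); apply: ler_wpM2l.
      by rewrite exprn_ge0 //; lra.
    exact: ler_wiXn2l.
  apply: lerXn2r; rewrite ?nnegrE ?mulr_ge0 ?exprn_ge0 //; [lra|].
  by rewrite sgE hE bE; lra.
have bm0 : 0 < (b ^+ 2) ^+ m1 by rewrite !exprn_gt0.
rewrite -(ler_pM2r bm0); apply: le_trans main2 _.
have -> : h ^+ 2 = sg * (2 * b ^+ 2) by rewrite sgE divfK // lt0r_neq0 // mulr_gt0 ?exprn_gt0.
rewrite (exprMn m1 sg) (exprMn m1 2) cB (exprD 2) [leRHS](_ : _ =
  2 ^+ #|B0| * (2 ^+ m1 * (b ^+ 2) ^+ m1)); last by ring.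
rewrite [leLHS](_ : _ = (9 / 4) ^+ #|B0| * sg ^+ m1 * (2 ^+ m1 * (b ^+ 2) ^+ m1)); last by ring.
by apply: ler_wpM2r small; rewrite mulr_ge0 ?exprn_ge0 // ltW.
Qed.

End Involutionless.
End OneShift.

(** * The link graph of [{0, s}] with [2 s = 0]: a disjoint union of cliques *)

Section Classes.
Context {G : finZmodType} (chi : G -> bool).
Hypothesis chiD : forall x y, chi (x + y) = chi x (+) chi y.
Variable s : G.
Hypotheses (chis : ~~ chi s) (ss : s + s = 0).
Implicit Types (x y z v w : G) (U : {set G}).

Local Notation B := (coset chi).
Local Notation lk := (link [set 0; s]).

Definition cls x := [set x; x + s; - x; s - x].

(** The element 0 joins [x] to [- x], while [s] joins it to [s - x] and, because [2 s = 0], to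
    [x + s] in both directions. *)
Lemma cnbh_cls x : x \in B -> cnbh lk x :&: B = cls x.
Proof.
move=> xB; have ev z : z \in [set 0; s] -> ~~ chi z.
  by rewrite !inE => /orP[]/eqP ->; rewrite ?(chi0 chiD).
apply/setP => y; rewrite inE in_setU1 [y \in nbh _ _]inE.
have [yx|yx] /= := eqVneq y x; first by rewrite yx xB !inE eqxx.
apply/andP/idP => [[xy yB]|].
  move: xy; rewrite (link_coset ev xB yB) => /andP[_ /exists_inP[z]].
  rewrite !inE => /orP[]/eqP -> /or3P[]/eqP h.
  - by rewrite (_ : y = - x) ?eqxx ?orbT //; zmod_from h.
  - by case/eqP: yx; rewrite -h addr0.
  - by case/eqP: yx; rewrite -h addr0.
  - by rewrite (_ : y = s - x) ?eqxx ?orbT //; zmod_from h.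
  - by rewrite -h eqxx ?orbT.
  - have e : y + s = x + (s + s) by rewrite ss addr0.
    by rewrite (_ : y = x + s) ?eqxx ?orbT //; zmod_from e.
move=> yc; have yB : y \in B.
  move: yc xB; rewrite !inE -!orbA => /or4P[]/eqP ->;
  by rewrite ?chiD ?(chiN chiD) ?(negPf chis) // => ->.
split=> //; rewrite (link_coset ev xB yB) eq_sym yx /=; apply/exists_inP.
move: yc; rewrite !inE (negPf yx) /= -!orbA => /or3P[]/eqP ->.
- by exists s; rewrite ?inE eqxx ?orbT.
- by exists 0; rewrite ?inE ?subrr eqxx.
- by exists s; rewrite ?inE ?eqxx ?orbT // addrC subrK eqxx.
Qed.

Lemma cls_eq x y : y \in cls x -> cls y = cls x.
Proof.
have perm a b c d : [set a; b; c; d] = [set b; a; d; c] :> {set G}.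
  by apply/setP => z; rewrite !inE; case: (z == a); case: (z == b); case: (z == c); case: (z == d).
have perm2 a b c d : [set a; b; c; d] = [set c; d; a; b] :> {set G}.
  by apply/setP => z; rewrite !inE; case: (z == a); case: (z == b); case: (z == c); case: (z == d).
have e1 : x + s + s = x by zmod_from ss.
have e2 : - (x + s) = s - x by zmod_from ss.
have e3 : s - (x + s) = - x by zmod.
have e4 : s - - x = x + s by zmod.
have e5 : - x + s = s - x by zmod.
have e6 : s - x + s = - x by zmod_from ss.
have e7 : - (s - x) = x + s by zmod_from ss.
have e8 : s - (s - x) = x by zmod.
rewrite {1}/cls !inE -!orbA => /or4P[]/eqP ->; rewrite /cls //.
- by rewrite e1 e3 e2 perm.
- by rewrite e4 opprK e5 perm2.
by rewrite e6 e8 e7 perm perm2.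
Qed.

Lemma card_cls x : s != 0 -> (#|cls x| == 2) || (#|cls x| == 4).
Proof.
move=> s0; have n1 y : y != y + s by apply: contra s0 => /eqP h; apply/eqP; zmod_from h.
have e1 : s - x = - x + s by rewrite addrC.
have [h|h] := boolP (- x \in [set x; x + s]).
  suff -> : cls x = [set x; x + s] by rewrite cards2 n1.
  apply/setP => z; rewrite /cls e1 !inE -!orbA; move: h; rewrite !inE => /orP[]/eqP h.
    by rewrite h; case: (z == x); case: (z == x + s).
  by rewrite h -addrA ss addr0; case: (z == x); case: (z == x + s).
apply/orP; right; rewrite /cls e1; have -> : [set x; x + s; - x; - x + s] = [set x; x + s] :|: [set - x; - x + s].
  by apply/setP => z; rewrite !inE -!orbA.
have d : [set x; x + s] :&: [set - x; - x + s] = set0.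
  apply/setP => z; rewrite !inE; apply/negP => /andP[zx /orP[]/eqP zE].
    by case/negP: h; rewrite -zE !inE.
  case/negP: h; rewrite (_ : - x = z + s); last by rewrite zE; have h : - x + (s + s) = - x + s + s; [zmod|rewrite -h ss addr0].
  by move: zx; rewrite !inE => /orP[]/eqP ->; rewrite ?eqxx ?orbT // -addrA ss addr0 eqxx.
by rewrite cardsU d cards0 subn0 !cards2 !n1.
Qed.

Definition closed_cls U := U \subset B /\ forall x, x \in U -> cls x \subset U.

Lemma closed_clsD U x : x \in U -> closed_cls U -> closed_cls (U :\: cls x).
Proof.
move=> xU [UB hU]; split; first by apply: subset_trans UB; exact: subsetDl.
move=> y /setDP[yU yx]; rewrite subsetD hU //=; apply/pred0P => z /=.
apply/negP => /andP[zy zx]; case/negP: yx; rewrite -(cls_eq zx) (cls_eq zy).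
by rewrite !inE eqxx.
Qed.

Lemma setD_cnbh U x : x \in U -> closed_cls U -> U :\: cnbh lk x = U :\: cls x.
Proof.
move=> xU [UB hU]; have xB := subsetP UB x xU; rewrite -(cnbh_cls xB).
apply/setP => z; rewrite !in_setD in_setI; case: (boolP (z \in U)) => zU; rewrite ?andbF //.
by rewrite (subsetP UB z zU) !andbT.
Qed.

(** The class is an isolated clique, from which exactly one vertex is chosen, independently of the
    rest. *)
Lemma nmis_cls U x : x \in U -> closed_cls U -> nmis lk U = (#|cls x| * nmis lk (U :\: cls x))%N.
Proof.
move=> xU cU; have [UB hU] := cU; have xB := subsetP UB x xU.
have cI : cnbh lk x :&: U = cls x.
  rewrite -(cnbh_cls xB); apply/setP => z; rewrite !in_setI; have [zx|//] := boolP (z \in cnbh lk x).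
  apply/idP/idP => [/(subsetP UB)//|zB]; apply: (subsetP (hU x xU)).
  by rewrite -(cnbh_cls xB) inE zx.
have sub u : u \in cls x -> U :\: cnbh lk u = U :\: cls x.
  by move=> ux; rewrite setD_cnbh ?(cls_eq ux) //; exact: (subsetP (hU x xU)).
apply/eqP; rewrite eqn_leq; apply/andP; split.
  apply: leq_trans (nmis_nbh (@link_sym G _) xU) _; rewrite cI.
  by rewrite -sum_nat_const; apply: leq_sum => u ux; rewrite sub.
pose f (p : G * {set G}) := p.1 |: p.2.
pose D := setX (cls x) [set I | mis lk (U :\: cls x) I].
have DP u I : (u, I) \in D -> u \in cls x /\ I \subset U :\: cls x.
  by rewrite !inE /= => /andP[ux /misP[IU _ _]]; split=> //; rewrite !inE.
have inj : {in D &, injective f}.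
  move=> [u I] [v K] /DP[ux IU] /DP[vx KU]; rewrite /f /= => e.
  have trI w (L : {set G}) : w \in cls x -> L \subset U :\: cls x -> (w |: L) :\: cls x = L.
    move=> wx LU; apply/setP => z; rewrite in_setD in_setU1.
    case: (boolP (z \in L)) => zL; first by have := subsetP LU z zL; rewrite in_setD orbT => /andP[->].
    by rewrite orbF; apply/negP => /andP[zx /eqP zw]; rewrite zw wx in zx.
  have trII w (L : {set G}) : w \in cls x -> L \subset U :\: cls x -> (w |: L) :&: cls x = [set w].
    move=> wx LU; apply/setP => z; rewrite in_setI in_setU1 in_set1.
    have [->|zw] := eqVneq z w; first by rewrite wx.
    by apply/negP => /andP[/(subsetP LU)]; rewrite in_setD => /andP[/negPf ->].
  have := trII u I ux IU; rewrite e trII // => /set1_inj ->.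
  by have := trI u I ux IU; rewrite e trI // => ->.
rewrite -[X in (_ * X)%N]/(#|[set I | mis lk (U :\: cls x) I]|) -cardsX -(card_in_imset inj).
apply/subset_leq_card/subsetP => _ /imsetP[[u I] uI ->]; have [ux IU] := DP u I uI.
move: uI; rewrite in_setX inE => /andP[_]; rewrite inE => /misP[_ iI mI].
have uU := subsetP (hU x xU) u ux; have uc := sub u ux.
have nadj y : y \in I -> ~~ lk u y.
  move=> /(subsetP IU); rewrite -uc in_setD in_setU1 inE => /andP[+ _].
  by rewrite negb_or => /andP[].
suff : mis lk U (u |: I) by rewrite ?inE.
apply/misP; split.
- by rewrite subUset sub1set uU; apply: subset_trans IU (subsetDl _ _).
- move=> a b /setU1P[->|aI] /setU1P[->|bI].
  + by rewrite link_irr.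
  + exact: nadj.
  + by rewrite link_sym nadj.
  + exact: iI.
move=> y yU; rewrite in_setU1 negb_or => /andP[yu yI].
have [uy|uy] := boolP (lk u y); first by exists u; [exact: setU11|rewrite link_sym].
have [|z zI yz] := mI y _ yI; last by exists z; rewrite // in_setU1 zI orbT.
by rewrite -uc in_setD in_setU1 negb_or yu inE uy yU.
Qed.

(** The count is the product of the class sizes, and [k ^ 2 = 2 ^ k] for [k = 2, 4]; a class of size
    1 falls short by a factor 2. *)
Lemma nmis_closed_cls U : closed_cls U ->
  (forall x, x \in U -> [|| #|cls x| == 1, #|cls x| == 2 | #|cls x| == 4])%N ->
  (nmis lk U ^ 2 * 2 ^ #|[set x in U | #|cls x| == 1%N]| = 2 ^ #|U|)%N.
Proof.
have [n] := ubnP #|U|; elim: n U => // n IHn U; rewrite ltnS => hn cU hcls.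
have [U0|[x xU]] := set_0Vmem U.
  have -> : nmis lk U = 1%N.
    apply/eqP; rewrite U0 eqn_leq nmis_set0 card_gt0; apply/set0Pn; exists set0.
    rewrite inE; apply/misP; split=> // [y z|y]; by rewrite inE.
  by rewrite U0 (_ : [set y in set0 | _] = set0) ?cards0 //; apply/setP => y; rewrite !inE.
have clsU : cls x \subset U by have [_ hU] := cU; exact: hU.
have xx : x \in cls x by rewrite !inE eqxx.
have cD := closed_clsD xU cU.
have lt_card : (#|U :\: cls x| < n)%N.
  apply: leq_trans hn; apply: proper_card; apply/properP; split; first exact: subsetDl.
  by exists x => //; rewrite inE xx.
have hD y : y \in U :\: cls x -> [|| #|cls y| == 1, #|cls y| == 2 | #|cls y| == 4]%N.
  by move=> /setDP[yU _]; apply: hcls.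
have IH := IHn _ lt_card cD hD.
rewrite (nmis_cls xU cU) -(cardsID (cls x) U) (setIidPr clsU) expnD -IH expnMn.
have -> : #|[set y in U | #|cls y| == 1%N]| =
    ((#|cls x| == 1) + #|[set y in U :\: cls x | #|cls y| == 1]|)%N.
  rewrite -[LHS](cardsID (cls x)).
  have -> : [set y in U | #|cls y| == 1%N] :\: cls x = [set y in U :\: cls x | #|cls y| == 1%N].
    by apply/setP => y; rewrite in_setD 2![y \in [set _ | _]]inE in_setD andbA.
  congr (_ + _)%N; have [c1|c1] := eqVneq #|cls x| 1%N.
    rewrite -[RHS]c1; apply: eq_card => y; rewrite in_setI [y \in [set _ | _]]inE.
    have [yx|] := boolP (y \in cls x); rewrite ?andbF ?andbT //.
    by rewrite (cls_eq yx) c1 eqxx (subsetP clsU y yx).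
  apply/eqP; rewrite cards_eq0; apply/eqP/setP => y; rewrite in_setI [y \in [set _ | _]]inE in_set0.
  by apply/negP => /andP[/andP[_ cy]] /cls_eq e; rewrite e (negPf c1) in cy.
by case/or3P: (hcls x xU) => /eqP ->; rewrite /= ?expnD; lia.
Qed.

Lemma closed_cls_coset : closed_cls B.
Proof. by split=> // x xB; rewrite -(cnbh_cls xB) subsetIr. Qed.

Lemma nmis_two_shifts : s != 0 -> (nmis lk B ^ 2 = 2 ^ #|B|)%N.
Proof.
move=> s0; rewrite -(nmis_closed_cls closed_cls_coset) => [|x _]; last by rewrite orbC card_cls.
rewrite (_ : [set x in B | _] = set0) ?cards0 ?muln1 //.
by apply/setP => x; rewrite !inE; case/orP: (card_cls x s0) => /eqP ->; rewrite andbF.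
Qed.

End Classes.

(** The preceding results with [s = 0], where the classes are [{x, - x}]. Two singleton classes in
    the coset would differ by a nonzero even element of order 2, so at most one factor 2 is lost. *)
Lemma nmis_zero_shift (G : finZmodType) (chi : G -> bool) :
  (forall x y, chi (x + y) = chi x (+) chi y) ->
  (forall s, s + s = 0 -> ~~ chi s -> s = 0) ->
  (2 ^ #|coset chi| <= 2 * nmis (link [set 0%R; 0%R]) (coset chi) ^ 2)%N.
Proof.
move=> chiD h0; have chi00 : ~~ chi 0 by rewrite (chi0 chiD).
have s00 : 0 + 0 = 0 :> G by rewrite addr0.
have clsE x : cls 0 x = [set x; - x].
  by apply/setP => y; rewrite !inE addr0 add0r; case: (y == x); case: (y == - x).
rewrite -(nmis_closed_cls chiD chi00 s00 (closed_cls_coset chiD chi00 s00)) => [|x _]; last first.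
  by rewrite clsE cards2; case: (_ != _).
rewrite mulnC leq_mul2r; apply/orP; right; rewrite (leq_exp2l _ 1) //.
rewrite leqNgt; apply/negP => /card_gt1P[x [y []]].
rewrite !inE !clsE !cards2 => /andP[cx hx] /andP[cy hy] /eqP xy; apply: xy.
have {}hx : x = - x by move: hx; case: (eqVneq x (- x)).
have {}hy : y = - y by move: hy; case: (eqVneq y (- y)).
suff : x - y = 0 by move/eqP; rewrite subr_eq0 => /eqP.
apply: h0; last by rewrite chiD (chiN chiD) cx cy.
have e : x + x - (y + y) = 0 by rewrite {2}hx {2}hy !subrr.
by zmod_from e.
Qed.

(** If [2 s != 0] for some [s] in [E], a second element [t] gives four shifts with [p = s],
    [q = - s]. If all doubles vanish, two nonzero elements give four shifts with [p = t], [q = s].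
    Otherwise [E] is [{s}], [{0, s}] with [2 s = 0], or empty. *)
Lemma nmis_coset (R : rcfType) (G : finZmodType) (chi : G -> bool) (E : {set G}) k :
  (forall x y, chi (x + y) = chi x (+) chi y) -> (forall s, s \in E -> ~~ chi s) ->
  (forall c, #|[set x : G | (x + x)%R == c]| <= k)%N -> (192 * k <= #|coset chi|)%N ->
  (nmis (link E) (coset chi))%:R ^+ 2 <= 2 ^+ #|coset chi| :> R.
Proof.
move=> chiD evE hk ks.
have [/exists_inP[s sE s2]|] := boolP [exists s in E, s + s != 0].
  have [/exists_inP[t tE st]|] := boolP [exists t in E, s != t].
    apply: (@nmis_four_shifts R G chi chiD E s (- s) s t k) => //.
    - by apply: contra s2 => /eqP h; apply/eqP; zmod_from h.
    - by apply: contra s2 => /eqP ->; rewrite addr0.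
    - by rewrite oppr_eq0; apply: contra s2 => /eqP ->; rewrite addr0.
    - by rewrite sE.
    - by rewrite opprK sE orbT.
    - by rewrite opprK !inE !eqxx orbT.
  rewrite negb_exists_in => /forall_inP h.
  have -> : E = [set s].
    apply/setP => t; rewrite inE; apply/idP/eqP => [/h|-> //].
    by rewrite negbK => /eqP.
  exact: (nmis_one_shift chiD (evE s sE) s2 hk ks).
rewrite negb_exists_in => /forall_inP h2.
have {}h2 s : s \in E -> s + s = 0 by move=> /h2; rewrite negbK => /eqP.
have [/card_gt1P[s [t []]]|] := ltnP 1 #|E :\ 0|.
  rewrite !inE => /andP[s0 sE] /andP[t0 tE] st.
  have Ns : - s = s by have h := h2 s sE; zmod_from h.
  have Nt : - t = t by have h := h2 t tE; zmod_from h.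
  apply: (@nmis_four_shifts R G chi chiD E s t s t k) => //.
  - by rewrite sE.
  - by rewrite tE.
  - by rewrite Ns Nt !inE !eqxx orbT.
have one s : E = [set s] -> s + s = 0 ->
    (nmis (link E) (coset chi))%:R ^+ 2 <= 2 ^+ #|coset chi| :> R.
  move=> ES ss; have sE : s \in E by rewrite ES set11.
  by rewrite ES; apply: (nmis_one_involution (evE s sE) ss).
rewrite leq_eqVlt ltnS leqn0 cards_eq0 => /orP[/cards1P[s Es]|/eqP E0].
  have sE0 : s \in E :\ 0 by rewrite Es set11.
  move: (sE0); rewrite !inE => /andP[s0 sE].
  have [zE|zE] := boolP (0 \in E); last first.
    apply: (one s); last exact: h2.
    by rewrite -Es; apply/setP => x; rewrite !inE; case: eqP => // ->; rewrite (negPf zE).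
  have -> : E = [set 0; s] by rewrite -(setD1K zE) Es.
  by rewrite -natrX (nmis_two_shifts chiD (evE s sE) (h2 s sE) s0) natrX.
have [zE|zE] := boolP (0 \in E).
  by apply: (one 0); rewrite ?addr0 // -(setD1K zE) E0 setU0.
have {E0 one}E0 : E = set0.
  by rewrite -E0; apply/setP => x; rewrite !inE; case: eqP => // ->; rewrite (negPf zE).
have h1 : (nmis (link E) (coset chi) <= 1)%N.
  rewrite -(cards1 (coset chi)); apply/subset_leq_card/subsetP => I; rewrite !inE => /misP[IU _ mI].
  rewrite eqEsubset IU; apply/subsetP => x xB; apply: contraT => xI.
  by have [y _ /exists_inP[z]] := mI x xB xI; rewrite E0 inE.
apply: (@le_trans _ _ 1); last by rewrite exprn_ege1 //; lra.
by rewrite expr_le1 // (ler_nat _ _ 1).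
Qed.

(** * Counting maximal distinct sum-free sets *)

(** By parity, a triple in [I :|: E] has two odd elements, adjacent in the link graph, or lies in
    [E], which has at most two elements. Different [I], [K] need different extensions: some point of
    one set is linked through [E] to a point of the other. *)
Lemma nmis_le_fstar_max (G : finZmodType) (chi : G -> bool) s :
  (forall x y, chi (x + y) = chi x (+) chi y) -> ~~ chi s ->
  (nmis (link [set 0%R; s]) (coset chi) <= fstar_max G)%N.
Proof.
move=> chiD chis; set B := coset chi; set E := [set 0; s].
have evE z : z \in E -> ~~ chi z by rewrite !inE => /orP[]/eqP ->; rewrite ?(chi0 chiD).
have ext (I : {set G}) : mis (link E) B I ->
    exists M, M \in max_distinct_sum_free G /\ I :|: E \subset M.
  move=> /misP[IB iI _]; have [|M maxM IM] := @maxset_exists _ (@distinct_sum_free G) (I :|: E).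
    apply/distinct_sum_freeP => x y z xI yI zI; apply/negP => t.
    have /and4P[/eqP xyz xy xz yz] := t.
    have par u : u \in I :|: E -> (chi u -> u \in I) /\ (~~ chi u -> u \in E).
      rewrite inE => /orP[uI|uE]; last by split=> // chiu; move: (evE u uE); rewrite chiu.
      by split=> // chiu; have := subsetP IB u uI; rewrite inE (negPf chiu).
    have [hx hx'] := par x xI; have [hy hy'] := par y yI; have [hz hz'] := par z zI.
    have := chiD x y; rewrite xyz.
    case cx: (chi x) hx hx'; case cy: (chi y) hy hy'; case cz: (chi z) hz hz' => //= hz hz' hy hy' hx hx' _.
    - have := iI x y (hx isT) (hy isT); case/negP; apply/exists_inP; exists z; first exact: hz'.
      by rewrite t.
    - have := iI x z (hx isT) (hz isT); case/negP; apply/exists_inP; exists y; first exact: hy'.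
      by rewrite t orbT.
    - have := iI y z (hy isT) (hz isT); case/negP; apply/exists_inP; exists x; first exact: hx'.
      by rewrite (distinct_schur_tripleC y x) t orbT.
    - have := hx' isT; have := hy' isT; have := hz' isT; rewrite !inE.
      by move=> /orP[]/eqP zE /orP[]/eqP yE /orP[]/eqP xE; move: xy xz yz; rewrite xE yE zE eqxx.
  by exists M; rewrite inE.
have /fin_all_exists[f hf] : forall I : {set G}, exists M : {set G}, mis (link E) B I ->
    M \in max_distinct_sum_free G /\ I :|: E \subset M.
  move=> I; have [mI|nI] := boolP (mis (link E) B I); last by exists set0.
  by have [M hM] := ext I mI; exists M.
rewrite /nmis /fstar_max -(@card_in_imset _ _ f).
  by apply/subset_leq_card/subsetP => _ /imsetP[I + ->]; rewrite inE => /hf[].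
have sub I K : mis (link E) B I -> mis (link E) B K -> f I = f K -> I \subset K.
  move=> mI mK fIK; have [_ IM] := hf I mI; have [Kmax KM] := hf K mK.
  have /misP[IB _ _] := mI; have /misP[_ _ maxK] := mK.
  apply/subsetP => x xI; apply: contraT => xK.
  have [y yK xy] := maxK x (subsetP IB x xI) xK.
  move: Kmax; rewrite inE => /maxsetP[sfM _].
  have EM : E \subset f K by apply: subset_trans KM; exact: subsetUr.
  have := link_sumfree (x := x) (y := y) sfM EM _ _; rewrite xy; apply.
    by rewrite -fIK; apply: (subsetP IM); rewrite inE xI.
  by apply: (subsetP KM); rewrite inE yK.
move=> I K; rewrite !inE => mI mK e; apply/eqP; rewrite eqEsubset.
by rewrite (sub I K) // (sub K I).
Qed.

Lemma fstar_max_ge (G : finZmodType) (chi : G -> bool) :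
  (forall x y, chi (x + y) = chi x (+) chi y) -> (exists x, chi x) ->
  (2 ^ #|G| <= 4 * fstar_max G ^ 4)%N.
Proof.
move=> chiD ex; rewrite -(card_coset chiD ex) mulnC expnM.
have -> : (4 * fstar_max G ^ 4 = (2 * fstar_max G ^ 2) ^ 2)%N by rewrite expnMn -expnM.
rewrite leq_exp2r //; have chi00 : ~~ chi 0 by rewrite (chi0 chiD).
have [/existsP[s /and3P[s0 /eqP ss chis]]|] := boolP [exists s, [&& s != 0, s + s == 0 & ~~ chi s]].
  rewrite -(nmis_two_shifts chiD chis ss s0); apply: (@leq_trans (fstar_max G ^ 2)); last by rewrite leq_pmull.
  by rewrite leq_exp2r // nmis_le_fstar_max.
rewrite negb_exists => /forallP h.
apply: leq_trans (nmis_zero_shift chiD _) _.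
  move=> s ss chis; have := h s; rewrite ss eqxx chis /= !andbT negbK; exact: eqP.
by rewrite leq_mul2l /= leq_exp2r // nmis_le_fstar_max.
Qed.

Section UpperBound.
Context {R : archiRcfType}.

(** Group the maximal sets by their part outside [X], for which there are at most [2 ^ #|F :\: X|]
    possibilities. *)
Lemma card_max_sub (G : finZmodType) (F X : {set G}) (y : R) :
  (forall x y z, x \in X -> y \in X -> z \in X -> ~~ distinct_schur_triple x y z) ->
  (forall S : {set G}, S \subset F :\: X -> (nmis (link S) X)%:R <= y) ->
  #|[set M in max_distinct_sum_free G | M \subset F]|%:R <= (2 ^ #|F :\: X|)%:R * y.
Proof.
move=> sfX hy; rewrite -card_powerset.
pose L S := [set M in max_distinct_sum_free G | M :\: X == S].
apply: (@le_trans _ _ #|\bigcup_(S in powerset (F :\: X)) L S|%:R).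
  rewrite ler_nat; apply/subset_leq_card/subsetP => M; rewrite inE => /andP[maxM MF].
  apply/bigcupP; exists (M :\: X); first by rewrite powersetE setSD.
  by rewrite inE maxM eqxx.
apply: card_bigcup_le => S; rewrite powersetE => SF; apply: le_trans (hy S SF).
by rewrite ler_nat card_max_le_nmis.
Qed.

Lemma fstar_max_le (c : R) : 1 < c -> exists N : nat, forall (G : finZmodType) (k : nat),
  (N <= #|G|)%N -> (forall d, #|[set x : G | (x + x)%R == d]| <= k)%N ->
  (384 * k <= #|G|)%N ->
  (fstar_max G)%:R <= c ^+ #|G| * Num.sqrt (Num.sqrt (2 ^+ #|G|)).
Proof.
move=> c1; have [d d1 dc] := sqrt_gt1 c1.
(* A set of at most [n / q] elements then has at most [d ^+ n] subsets, so removal is applied with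
   [1 / q]. *)
have [q [q0 hq]] : exists q : nat, (0 < q)%N /\ 2 <= d ^+ q.
  have [N HN] := poly_le_exp 0 d1; exists N.+1; split=> //.
  by have := HN N.+1 (leqnSn N); rewrite expn0 muln1.
have e0 : 0 < q%:R^-1 :> R by rewrite invr_gt0 ltr0n.
have [delta delta0 hdelta] := schur_removal e0.
have [N HN] := containers delta0 d1.
exists N => G k hN hk hkn; have [L [cL hL iL]] := HN G hN.
set n := #|G| in hN hkn cL hL *; pose y : R := Num.sqrt (Num.sqrt (2 ^+ n)).
have y0 : 0 <= y by exact: sqrtr_ge0.
have p2 j : 0 <= 2 ^+ j :> R by rewrite exprn_ge0.
have y2 : y ^+ 2 = Num.sqrt (2 ^+ n) by rewrite sqr_sqrtr ?sqrtr_ge0.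
have y4 : y ^+ 4 = 2 ^+ n by rewrite (exprM _ 2 2) y2 sqr_sqrtr.
have dn1 : 1 <= d ^+ n by rewrite exprn_ege1 // ltW.
have main F : F \in L -> #|[set M in max_distinct_sum_free G | M \subset F]|%:R <= d ^+ n * y.
  move=> FL; have [F0 [F0F cF0 sfF0]] := hdelta G F (hL F FL).
  have pow (X : {set G}) : X \subset F :\: F0 -> (2 ^ #|X|)%:R <= d ^+ n.
    move=> XF; have cX : (#|X| * q <= n)%N.
      rewrite -(ler_nat R) natrM -ler_pdivlMr ?ltr0n // mulrC.
      by apply: le_trans cF0; rewrite ler_nat subset_leq_card.
    rewrite natrX; apply: (@le_trans _ _ ((d ^+ q) ^+ #|X|)).
      by apply: lerXn2r; rewrite ?nnegrE ?exprn_ge0 //; lra.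
    by rewrite -exprM; apply: ler_weXn2l; [exact: ltW|rewrite mulnC].
  have sf (X : {set G}) : (forall x y, x \in X -> y \in X -> x + y \notin X) ->
      forall x y z, x \in X -> y \in X -> z \in X -> ~~ distinct_schur_triple x y z.
    move=> h u v w uX vX wX; rewrite /distinct_schur_triple.
    by apply/negP => /and4P[/eqP e _ _ _]; have := h u v uX vX; rewrite e wX.
  have [small|big] := leqP (5 * #|F0|)%N (2 * n)%N.
    apply: le_trans (card_max_sub (sf _ sfF0) _ (y := y)) _; last first.
      by apply: ler_wpM2r => //; apply: pow.
    move=> S _; pose g : R := 13 / 9.
    have g1 : 1 <= g by rewrite /g; lra.
    apply: le_trans (nmis_le_weight (@link_sym G S) g1 (fun=> lexx g) (@natr_le_expr R) F0) _.
    (* Eighth powers clear the fractions: (13/9)^8 <= 2^5, and [5 * #|F0| <= 2 * n] is the case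
       assumption. *)
    rewrite /weight prodr_const -(ler_pXn2r (n := 8)) ?nnegrE ?exprn_ge0 //; last by lra.
    rewrite exprAC (exprM y 4 2) y4; apply: (@le_trans _ _ ((2 ^+ 5) ^+ #|F0|)).
      by apply: lerXn2r; rewrite ?nnegrE ?exprn_ge0 //; rewrite /g; lra.
    by rewrite -!exprM; apply: ler_weXn2l; rewrite ?ler1n // [leqRHS]mulnC.
  have [chi [chiD hchi]] := sum_free_in_coset sfF0 big.
  have exchi : exists x, chi x.
    have : (0 < #|F0|)%N by clear -big; lia.
    by case/card_gt0P => x /hchi; exists x.
  (* Enlarging [F0] to the coset does not add possible outer parts, and it makes all of them even,
     as [nmis_coset] requires. *)
  have FB : F :\: coset chi \subset F :\: F0.
    by apply: setDS; apply/subsetP => x; rewrite inE; exact: hchi.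
  apply: le_trans (card_max_sub (X := coset chi) _ _ (y := y)) _; last first.
  - by apply: ler_wpM2r => //; apply: pow.
  - move=> S /subsetP SF; have cB := card_coset chiD exchi.
    have evS s : s \in S -> ~~ chi s by move=> /SF; rewrite !inE => /andP[].
    have kB : (192 * k <= #|coset chi|)%N by move: hkn; rewrite /n -cB; clear; lia.
    rewrite -(ler_pXn2r (n := 4)) ?nnegrE // y4 (exprM _ 2 2).
    have h := nmis_coset R chiD evS hk kB.
    apply: (@le_trans _ _ ((2 ^+ #|coset chi|) ^+ 2)).
      by apply: lerXn2r; rewrite ?nnegrE ?sqr_ge0.
    by rewrite -exprM /n -cB mulnC.
  - apply: sf => u v; rewrite !inE => cu cv; by rewrite chiD cu cv.
apply: (@le_trans _ _ #|\bigcup_(F in L) [set M in max_distinct_sum_free G | M \subset F]|%:R).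
  rewrite ler_nat; apply/subset_leq_card/subsetP => M maxM.
  have : distinct_sum_free M by move: maxM; rewrite inE => /maxsetP[].
  by move=> /iL[F FL MF]; apply/bigcupP; exists F; rewrite // inE maxM.
apply: le_trans (card_bigcup_le main) _.
rewrite -/y mulrA; apply: ler_wpM2r => //.
apply: (@le_trans _ _ (d ^+ n * d ^+ n)); first by apply: ler_wpM2r => //; lra.
by rewrite -exprMn; apply: lerXn2r; rewrite ?nnegrE -?expr2 ?sqr_ge0 //; lra.
Qed.

End UpperBound.

(** The only nonzero solution of [2 u = 0] is half the modulus, if there is one. *)
Lemma Zp_double_eq0 p (u v : 'Z_p) : u + u = 0 -> v + v = 0 -> (u == 0) = (v == 0) -> u = v.
Proof.
have arith (a N : nat) : (a < N -> 0 < a -> (a + a) %% N = 0 -> a + a = N)%N.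
  move=> aN a0; have [h|h] := ltnP (a + a) N; first by rewrite modn_small //; lia.
  by rewrite -(subnK h) modnDr modn_small; lia.
have half (w : 'Z_p) : w + w = 0 -> w != 0 -> (w + w = (Zp_trunc p).+2)%N.
  move=> /(congr1 val) /= ww w0; apply: arith => //.
  by rewrite lt0n; apply: contra w0 => /eqP h; apply/eqP/val_inj.
move=> uu vv uv; have [u0|u0] := eqVneq u 0.
  by apply/esym/eqP; rewrite -?uv u0 // -uv u0.
have v0 : v != 0 by rewrite -uv.
apply: val_inj => /=; have := half u uu u0; have := half v vv v0; clear; lia.
Qed.

Lemma double_eq0_odd (K : finZmodType) (x : K) : odd #|K| -> x + x = 0 -> x = 0.
Proof.
move=> oddK xx; have : (#[x]%g %| #|[set: K]|)%N by apply: order_dvdG; rewrite inE.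
have : (#[x]%g %| 2)%N by rewrite order_dvdn FinRing.zmodXgE mulr2n xx.
rewrite cardsT => d2 dK.
have : (#[x]%g %| gcdn 2 #|K|)%N by rewrite dvdn_gcd d2.
have -> : gcdn 2 #|K| = 1%N by apply/eqP; rewrite -/(coprime 2 _) coprime2n.
by rewrite dvdn1 order_eq1 => /eqP.
Qed.

Section Decomposition.
Variables (G K : finZmodType) (r : nat) (alpha : 'I_r -> nat).
Hypothesis dec : has_decomposition G K alpha.

(** Two solutions differ by an element with vanishing double, whose component in [K] is 0 and whose
    cyclic components are determined by whether they vanish. *)
Lemma card_doubles_decomposition c : odd #|K| ->
  (#|[set x : G | (x + x)%R == c]| <= 2 ^ r)%N.
Proof.
move=> oddK; have [f [bijf f1D f2D]] := dec.
have [->|[x0]] := set_0Vmem [set x : G | x + x == c]; first by rewrite cards0.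
rewrite inE => /eqP x0c.
pose h (x : G) : {ffun 'I_r -> bool} := [ffun i => (f (x - x0)).1 i == 0].
have -> : (2 ^ r = #|{ffun 'I_r -> bool}|)%N by rewrite card_ffun card_bool card_ord.
have injh : {in [set x : G | x + x == c] &, injective h}.
  move=> x y; rewrite !inE => /eqP xc /eqP yc hxy.
  have f10 i : (f 0).1 i = 0.
    by apply: (addrI ((f 0).1 i)); rewrite -f1D !addr0.
  have f20 : (f 0).2 = 0 by apply: (addrI (f 0).2); rewrite -f2D !addr0.
  have dbl z : z + z = c -> (z - x0) + (z - x0) = 0.
    by move=> zc; have e : z + z - (x0 + x0) = 0 by [rewrite zc x0c subrr]; zmod_from e.
  have dx := dbl x xc; have dy := dbl y yc.
  apply: (addIr (- x0)); apply: (bij_inj bijf).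
  rewrite [LHS]surjective_pairing [RHS]surjective_pairing; congr (_, _).
    apply/ffunP => i; apply: Zp_double_eq0; rewrite -?f1D ?dx ?dy ?f10 //.
    by have := congr1 (fun g : {ffun 'I_r -> bool} => g i) hxy; rewrite !ffunE.
  have k0 z : z + z = 0 -> (f z).2 = 0.
    by move=> zz; apply: double_eq0_odd oddK _; rewrite -f2D zz f20.
  by rewrite !k0.
by rewrite -(card_in_imset injh) max_card.
Qed.

(** The parity of the first cyclic coordinate is well defined because its modulus is even. *)
Lemma parity_decomposition : (0 < r)%N -> (forall i, (0 < alpha i)%N) ->
  exists chi : G -> bool, (forall x y, chi (x + y) = chi x (+) chi y) /\ exists x, chi x.
Proof.
move=> r0 alpha0; have [f [bijf f1D f2D]] := dec; pose i0 := Ordinal r0.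
exists (fun x => odd (val ((f x).1 i0))); split.
  move=> x y; rewrite f1D /= odd_mod ?oddD // Zp_cast ?oddX.
    by rewrite orbF; apply/negbTE; rewrite -lt0n alpha0.
  by rewrite -{1}(expn0 2) ltn_exp2l.
have [g _ gK] := bijf.
exists (g ([ffun i => (1 : 'Z_(2 ^ alpha i))] : {dffun forall i : 'I_r, 'Z_(2 ^ alpha i)}, 0)).
by rewrite gK /= ffunE.
Qed.

End Decomposition.

From mathcomp Require Import all_classical all_reals all_analysis.

Import Order.TTheory GRing.Theory Num.Theory.
Import numFieldNormedType.Exports.
Local Open Scope classical_set_scope.

Section ErrorTerm.
Context {R : realType}.

Definition log2 (x : R) : R := ln x / ln 2.

Lemma ln2_gt0 : 0 < ln (2 : R).
Proof. by apply: ln_gt0; lra. Qed.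

Lemma pow_log2 (x : R) : 0 < x -> 2 `^ log2 x = x.
Proof.
move=> x0; rewrite /powR; case: eqP => [h|_]; first by lra.
by rewrite /log2 divfK ?lnK // gt_eqF // ln2_gt0.
Qed.

(* The error term is the infimum of these sets, so that only large [n] matter. *)
Definition error_bound (n : nat) : set R := [set d | 0 <= d /\
  forall (G K : finZmodType) (r : nat) (alpha : 'I_r -> nat),
    #|G| = n -> (0 < r)%N -> (forall i : 'I_r, (0 < alpha i)%N) -> odd #|K| ->
    has_decomposition G K alpha -> (384%:R : R) <= n%:R / 2 ^+ r ->
    `|log2 (fstar_max G)%:R - n%:R / 4| <= d].

Lemma log2_fstar_max_ge (G : finZmodType) (chi : G -> bool) :
  (forall x y, chi (x + y) = chi x (+) chi y) -> (exists x, chi x) ->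
  (0 < fstar_max G)%N /\ #|G|%:R / 4 - 1 / 2 <= log2 (fstar_max G)%:R.
Proof.
move=> chiD ex; have h := fstar_max_ge chiD ex.
have f0 : (0 < fstar_max G)%N.
  rewrite lt0n; apply/eqP => f0; move: h; rewrite f0 leqNgt expn_gt0 //.
split=> //; have f0' : 0 < (fstar_max G)%:R :> R by rewrite ltr0n.
move: h; rewrite -(ler_nat R) natrM !natrX => h.
have : ln ((2 : R) ^+ #|G|) <= ln (4%:R * (fstar_max G)%:R ^+ 4).
  by rewrite ler_ln ?posrE ?mulr_gt0 ?exprn_gt0.
rewrite lnM ?posrE ?exprn_gt0 // !lnXn // (_ : 4%:R = 2 ^+ 2 :> R); last by lra.
rewrite lnXn // -(mulr_natr (ln 2) #|G|) -(mulr_natr (ln 2) 2) -(mulr_natr (ln _) 4).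
by rewrite /log2 ler_pdivlMr ?ln2_gt0 //; lra.
Qed.

(** Shows that the set is nonempty for every [n], so that its infimum is a greatest lower bound. *)
Lemma error_bound_trivial n : error_bound n (n%:R + 1).
Proof.
split=> [|G K r alpha cG r0 al0 oK dec _]; first by rewrite addr_ge0.
have [chi [chiD ex]] := parity_decomposition dec r0 al0.
have [f0 lo] := log2_fstar_max_ge chiD ex; rewrite cG in lo.
have f0' : 0 < (fstar_max G)%:R :> R by rewrite ltr0n.
have n0 : 0 <= n%:R :> R by [].
have hi : log2 (fstar_max G)%:R <= n%:R.
  rewrite /log2 ler_pdivrMr ?ln2_gt0 // mulr_natl -lnXn // ler_ln ?posrE ?exprn_gt0 //.
  rewrite -natrX ler_nat -cG -cardsT -card_powerset.
  by apply/subset_leq_card/fintype.subsetP => M _; rewrite powersetE finset.subsetT.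
by rewrite ler_norml; apply/andP; split; lra.
Qed.

Lemma error_bound_small (eps : R) : 0 < eps ->
  exists N : nat, forall n, (N <= n)%N -> error_bound n (eps * n%:R).
Proof.
(* This rate is [2 ^ eps], so that [c ^+ n] contributes exactly [eps * n] to the logarithm. *)
move=> eps0; have c1 : 1 < expR (eps * ln 2) by rewrite expR_gt1 mulr_gt0 ?ln2_gt0.
have [N HN] := fstar_max_le c1.
have [N2 HN2] : exists N2 : nat, 1 / eps < N2%:R.
  by eexists; apply: archi_boundP; rewrite divr_ge0 // ltW.
exists (maxn N N2) => n; rewrite geq_max => /andP[hN hN2].
split=> [|G K r alpha cG r0 al0 oK dec hC]; first by rewrite mulr_ge0 // ltW.
have [chi [chiD ex]] := parity_decomposition dec r0 al0.
have [f0 lo] := log2_fstar_max_ge chiD ex; rewrite cG in lo.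
have f0' : 0 < (fstar_max G)%:R :> R by rewrite ltr0n.
have n1 : 1 <= eps * n%:R.
  rewrite [leRHS]mulrC -ler_pdivrMr //; apply: le_trans (ltW HN2) _; by rewrite ler_nat.
have := HN G (2 ^ r)%N; rewrite cG => /(_ hN (fun c => card_doubles_decomposition dec c oK)).
rewrite ler_pdivlMr ?exprn_gt0 // -natrX -natrM ler_nat in hC.
move=> /(_ hC) up.
have p2 j : 0 < (2 : R) ^+ j by rewrite exprn_gt0.
set y := Num.sqrt _ in up.
have y0 : 0 < y by rewrite !sqrtr_gt0.
have y4 : y ^+ 4 = 2 ^+ n by rewrite (exprM _ 2 2) !sqr_sqrtr // ?sqrtr_ge0 // ltW.
have lny : ln y * 4 = n%:R * ln 2.
  by rewrite mulr_natr mulr_natl -!lnXn // y4.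
have hi : ln (fstar_max G)%:R <= n%:R * (eps * ln 2) + ln y.
  apply: (@le_trans _ _ (ln (expR (eps * ln 2) ^+ n * y))).
    by rewrite ler_ln ?posrE ?mulr_gt0 ?exprn_gt0 ?expR_gt0.
  by rewrite lnM ?posrE ?exprn_gt0 ?expR_gt0 // lnXn ?expR_gt0 // expRK mulr_natl.
have {}hi : log2 (fstar_max G)%:R <= eps * n%:R + n%:R / 4.
  by rewrite /log2 ler_pdivrMr ?ln2_gt0 //; lra.
by rewrite ler_norml; apply/andP; split; lra.
Qed.

Lemma has_inf_error_bound n : has_inf (error_bound n).
Proof.
split; first by exists (n%:R + 1); exact: error_bound_trivial.
by exists 0 => d [].
Qed.

End ErrorTerm.

Theorem theorem3p3 (R : realType) :
  exists (C : nat) (err : nat -> R),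
    (err n / n%:R @[n --> \oo] --> (0 : R)) /\
    forall (n : nat) (G K : finZmodType) (r : nat) (alpha : 'I_r -> nat),
      #|G| = n -> ~~ odd n ->
      (0 < r)%N -> (forall i : 'I_r, (0 < alpha i)%N) -> odd #|K| ->
      has_decomposition G K alpha ->
      (C%:R : R) <= n%:R / 2 ^+ r ->
      exists e : R, `|e| <= err n /\
        (fstar_max G)%:R = (2 : R) `^ (n%:R / 4 + e).
Proof.
exists 384%N, (fun n => inf (error_bound (R := R) n)); split.
  apply/cvgrPdist_le => eps eps0; have [N HN] := error_bound_small eps0.
  exists N.+1 => // n /= hn; rewrite sub0r normrN.
  have n0 : 0 < n%:R :> R by rewrite ltr0n (leq_trans _ hn).
  have i0 : 0 <= inf (error_bound (R := R) n).
    by apply: lb_le_inf; [have [] := has_inf_error_bound (R := R) n|move=> d []].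
  rewrite ger0_norm ?divr_ge0 // ler_pdivrMr //.
  by apply: ge_inf; [have [] := has_inf_error_bound (R := R) n|apply: HN; exact: ltnW].
move=> n G K r alpha cG _ r0 al0 oK dec hC.
exists (log2 (fstar_max G)%:R - n%:R / 4); split.
  (* Every member of the set bounds the deviation of this particular group, hence so does the
     infimum. *)
  apply: lb_le_inf; first by have [] := has_inf_error_bound (R := R) n.
  by move=> d [_ hd]; exact: (hd G K r alpha).
have [chi [chiD ex]] := parity_decomposition dec r0 al0.
have [f0 _] := log2_fstar_max_ge (R := R) chiD ex.
by rewrite addrC subrK pow_log2 // ltr0n.
Qed.
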